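(* Consider the system $\dot x=Lx+N(x)$ in $\mathbb{R}^n$, where $L$ is a real $n\times n$ matrix, $N\in C^\infty$, $N(0)=0$ and $N_x(0)=0$. Assume that all the eigenvalues of $L$ are real, negative and distinct, say $-\wedge_1>-\wedge_2>\dots>-\wedge_n$, and that for any $i\in\{1,\dots,n\}$ and any $(\chi_1,\dots,\chi_{i-1})\in\mathbb{N}^{i-1}$ one has $\wedge_i\ne\sum_{j=1}^{i-1}\chi_j\wedge_j$. Let $x(t)=(x_1(t),\dots,x_n(t))$ be a solution with $x(t)\to0$ as $t\to+\infty$. Then for any $\Theta>0$ one can find coefficients $c^\chi=(c^\chi_1,\dots,c^\chi_n)\in\mathbb{R}^n$, $\chi\in I_\Theta$, such that for any $s=1,\dots,n$ $$x_s(t)=\sum_{\chi\in I_\Theta}c^\chi_s\,e^{-(\chi_1\wedge_1+\dots+\chi_n\wedge_n)t}+o(e^{-(\Theta+\varepsilon)t})\qquad\text{as }t\to+\infty,\quad\chi=(\chi_1,\dots,\chi_n),$$ for $\varepsilon>0$ small enough. Moreover, denoting by $d_i$ the vector $c^\chi$ for $\chi$ with $\chi_i=1$ and $\chi_j=0$ for $j\ne i$, the coefficients $d_i$ depend only on $x(0)$, and the coefficients $c^\chi$ with $|\chi|:=\sum_j\chi_j>1$ are determined by the coefficients $d_i$. In fact, for any $\chi$ such that $\chi_j=0$ for $j\ge i+1$, $c^\chi$ is determined by $d_1,\dots,d_i$.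
   Context: $I_\Theta=\{\chi=(\chi_1,\dots,\chi_n)\in\mathbb{N}^n:\chi_1\wedge_1+\dots+\chi_n\wedge_n\le\Theta\}$, where $\mathbb{N}=\{0,1,2,\dots\}$. $N_x$ denotes the Jacobian matrix of $N$. The notation $h(t)=o(e^{-kt})$ means $h(t)e^{kt}\to0$ as $t\to+\infty$; $\varepsilon$ denotes a positive constant taken as small as needed. *)

(* Defs.v *)
From HB Require Import structures.
From mathcomp Require Import all_boot all_order all_algebra.
From mathcomp Require Import all_classical all_reals all_analysis.

Set Implicit Arguments.
Unset Strict Implicit.
Unset Printing Implicit Defensive.

Import Order.TTheory GRing.Theory Num.Theory.
Import numFieldNormedType.Exports.

Local Open Scope classical_set_scope.
Local Open Scope ring_scope.

(* Vectors of R^n are row vectors, as required by the library Jacobian ['J];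
   the vector L x is therefore written [x *m L^T]. *)

(* iterated partial derivatives of f along the coordinate directions in s *)
Fixpoint partials (R : realType) (n : nat) (s : seq 'I_n)
    (f : 'rV[R]_n -> 'rV[R]_n) : 'rV[R]_n -> 'rV[R]_n :=
  if s is i :: s' then partials s' ('D_(delta_mx 0 i) f) else f.

(* C^oo: partial derivatives of all orders exist and are continuous. *)
Definition smooth (R : realType) (n : nat) (f : 'rV[R]_n -> 'rV[R]_n) : Prop :=
  forall s : seq 'I_n,
    continuous (partials s f) /\
    forall (i : 'I_n) (p : 'rV[R]_n), derivable (partials s f) p (delta_mx 0 i).

(* Only x restricted to [0, +oo[ matters. Continuity at 0 together with the
   equation for t > 0 gives the one-sided equation at t = 0. *)
Definition is_solution (R : realType) (n : nat) (L : 'M[R]_n)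
    (N : 'rV[R]_n -> 'rV[R]_n) (x : R -> 'rV[R]_n) : Prop :=
  {within `[0, +oo[, continuous x} /\
  forall t : R, 0 < t -> is_derive t 1 x (x t *m L^T + N (x t)).

Definition multi_index (n : nat) := {ffun 'I_n -> nat}.

Definition unit_index (n : nat) (i : 'I_n) : multi_index n :=
  [ffun j => nat_of_bool (j == i)].

Definition weight (R : realType) (n : nat) (lam : 'I_n -> R)
    (chi : multi_index n) : R := \sum_(i < n) (chi i)%:R * lam i.

Definition index_set (R : realType) (n : nat) (lam : 'I_n -> R) (Theta : R) :
  set (multi_index n) := [set chi | weight lam chi <= Theta].

(* A sum [\sum_(chi \in index_set lam Theta) _] is a genuine finite sum: the
   library's default value 0 for infinitely supported sums is never used. *)
Lemma finite_index_set (R : realType) (n : nat) (lam : 'I_n -> R) (Theta : R) :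
  (forall i, 0 < lam i) -> finite_set (index_set lam Theta).
Proof.
move=> lam0.
pose M := \max_(i < n) Num.truncn (Theta / lam i).
apply: (@sub_finite_set _ _
  ((fun g : {ffun 'I_n -> 'I_M.+1} =>
     [ffun i => nat_of_ord (g i)] : multi_index n) @` setT)); last first.
  exact/finite_image/finite_finset.
move=> chi chiT.
have chiM i : (chi i < M.+1)%N.
  rewrite ltnS; apply: leq_trans (leq_bigmax i).
  suff chii : (chi i)%:R * lam i <= Theta.
    rewrite truncn_ge_nat ler_pdivlMr// mul0r.
    by rewrite (le_trans _ chii)// mulr_ge0// ltW.
  apply: le_trans chiT.
  rewrite /weight (bigD1 i)//= lerDl sumr_ge0// => j _.
  by rewrite mulr_ge0// ltW.
exists [ffun i => Ordinal (chiM i)] => //.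
by apply/ffunP => i; rewrite !ffunE.
Qed.

(* h(t) = o(e^(-kt)) as t -> +oo *)
Definition littleo_exp (R : realType) (k : R) (h : R -> R) : Prop :=
  h t * expR (k * t) @[t --> +oo] --> (0 : R).

(* Main.v *)
Require Import Defs.
From HB Require Import structures.
From mathcomp Require Import all_boot all_order all_algebra.
From mathcomp Require mpoly.

Set Implicit Arguments.
Unset Strict Implicit.
Unset Printing Implicit Defensive.

(** Look for the solution as a formal series X = sum_chi c^chi z^chi in the
    variables z_i = e^(- lam_i t).  Comparing the coefficients of z^chi in
    X' = L X + N(X) gives (- weight chi - L) c^chi = [z^chi] N(X).  Since N
    vanishes to second order at 0, the right-hand side only involves the c^nu
    with nu strictly below chi.  When |chi| > 1, nonresonance says that
    - weight chi is not an eigenvalue of L, hence c^chi is determined by the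
    coefficients d_j of degree one such that chi has a nonzero entry at some
    index >= j.  This recursion is carried out with polynomials in
    [FormalSolution.formal_solution].

    Let l be the smallest lam_i.  Truncating X at degree m gives a function
    Z_m that solves the equation up to a defect of rate (m + 1) l: all the
    monomials left over have a degree larger than m, and Taylor's formula
    [taylor_remainder] controls N(Z_m) ([expansion_residual]).

    Now let x be a solution that tends to 0.  It decays at rate l, by a
    Lyapunov argument ([apriori_decay]).  If x - Z_m decays at a rate K <= m l,
    it solves a linear system whose forcing term decays at rate K + l, because
    N is quadratic at 0.  In eigencoordinates this system splits into scalar
    equations g' = - lam_i g + h, whose solutions either inherit the rate of h
    ([linear_equation_fast]) or do so after subtraction of some
    b_i e^(- lam_i t) ([linear_equation_slow]).  Replacing d_i by d_i + b_i
    absorbs that term, and the other effects of this change on Z_m have rate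
    K + l ([expansion_shift], [expansion_improve]).  Then m increases by one and
    the argument starts again at rate K + l.  As b_i = 0 as soon as
    lam_i < K, the d_i are final after finitely many steps, and the expansion
    then holds to every order with the same d_i ([solution_expansion]).
    Finally the d_i only depend on x(0) because x does
    ([solution_unique]). *)

(** * The formal series solution *)

Module FormalSolution.
Import mpoly GRing.Theory.
Local Open Scope ring_scope.

Section Coefficients.
Variables (F : comNzRingType) (n : nat).
Variables (T : seq 'I_n -> 'rV[F]_n) (G : 'X_{1..n} -> 'M[F]_n).

Definition truncation (m : nat) (c : 'X_{1..n} -> 'rV[F]_n) (j : 'I_n) : {mpoly F[n]} :=
  \sum_(mu : 'X_{1..n < m.+1}) c mu 0 j *: 'X_[mu].

(** The Taylor polynomial of the nonlinearity, evaluated at polynomials [X].  The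
    derivatives are indexed by words of directions rather than by
    multi-indices: with [partials s N 0] divided by [(size s)!] as [T s], no
    multinomial coefficient appears. *)
Definition substitute (m : nat) (X : 'I_n -> {mpoly F[n]}) (j : 'I_n) :=
  \sum_(2 <= k < m.+1) \sum_(s : k.-tuple 'I_n)
    T s 0 j *: \prod_(i <- s) X i.

Definition forcing (m : nat) (X : 'I_n -> {mpoly F[n]}) (mu : 'X_{1..n}) :=
  \row_j (substitute m X j)@_mu.

(** Recursion on the degree, bounded by [fuel]: the coefficients of degree [k] are
    computed from the truncation at degree [k - 1].  In degree at most 1 the
    sum is [0] or the single [D i] of the monomial; in higher degree [G mu] is
    meant to be the inverse of [- weight mu - L]. *)
Fixpoint formal_coef_rec (D : 'I_n -> 'rV[F]_n) (fuel : nat) (mu : 'X_{1..n}) :=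
  if fuel is fuel'.+1 then
    if (mdeg mu <= 1)%N then \sum_(i < n) (mu i)%:R *: D i
    else forcing (mdeg mu) (truncation (mdeg mu).-1 (formal_coef_rec D fuel')) mu *m G mu
  else 0.

Definition formal_coef D mu := formal_coef_rec D (mdeg mu).+1 mu.

Lemma mcoeff_truncation m c j mu :
  (truncation m c j)@_mu = if (mdeg mu <= m)%N then c mu 0 j else 0.
Proof.
rewrite /truncation raddf_sum /=; case: ifP => [le_mu|nle_mu].
  pose mu' := BMultinom (le_mu : (mdeg mu < m.+1)%N).
  rewrite (bigD1 mu') //= mcoeffZ mcoeffX eqxx mulr1 big1 ?addr0 // => nu nu_neq.
  rewrite mcoeffZ mcoeffX [_ == mu](_ : _ = false) ?mulr0 //.
  by apply: contra_neqF nu_neq => /eqP nuE; apply/val_inj.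
rewrite big1 // => nu _; rewrite mcoeffZ mcoeffX [_ == mu](_ : _ = false) ?mulr0 //.
by apply/eqP => nuE; have := bmdeg nu; rewrite nuE ltnS nle_mu.
Qed.

Lemma eq_truncation m c c' j :
  (forall mu, (mdeg mu <= m)%N -> c mu = c' mu) -> truncation m c j = truncation m c' j.
Proof. by move=> eq_c; apply: eq_bigr => mu _; rewrite eq_c // -ltnS bmdeg. Qed.

Lemma formal_coef_recE D k l mu :
  (mdeg mu < k)%N -> (mdeg mu < l)%N -> formal_coef_rec D k mu = formal_coef_rec D l mu.
Proof.
elim: k l mu => // k IHk [//|l] mu; rewrite !ltnS => muk mul /=.
case: ifPn => //; rewrite -ltnNge => mu_gt1.
congr (_ *m _); apply/rowP => j; rewrite !mxE; congr (_@__).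
apply: eq_bigr => i _; apply: eq_bigr => s _; congr (_ *: _).
apply: eq_bigr => h _; apply: eq_truncation => nu.
rewrite -ltnS prednK ?(ltnW mu_gt1) // => nu_mu.
by apply: IHk; apply: leq_trans nu_mu _.
Qed.

Lemma formal_coefE D mu : formal_coef D mu =
  if (mdeg mu <= 1)%N then \sum_(i < n) (mu i)%:R *: D i
  else forcing (mdeg mu) (truncation (mdeg mu).-1 (formal_coef D)) mu *m G mu.
Proof.
rewrite {1}/formal_coef /=; case: ifPn => //; rewrite -ltnNge => mu_gt1.
congr (_ *m _); apply/rowP => j; rewrite !mxE; congr (_@__).
apply: eq_bigr => i _; apply: eq_bigr => s _; congr (_ *: _).
apply: eq_bigr => h _; apply: eq_truncation => nu.
rewrite -ltnS prednK ?(ltnW mu_gt1) // => nu_mu.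
exact: formal_coef_recE.
Qed.

Lemma formal_coef0 D : formal_coef D 0%MM = 0.
Proof. by rewrite formal_coefE mdeg0 /= big1 // => i _; rewrite mnm0E scale0r. Qed.

Lemma formal_coefU D i : formal_coef D U_(i)%MM = D i.
Proof.
rewrite formal_coefE mdeg1 /= (bigD1 i) //= mnm1E eqxx scale1r big1 ?addr0 // => j.
by rewrite mnm1E eq_sym => /negPf ->; rewrite scale0r.
Qed.

Lemma mdeg_ltm (nu mu : 'X_{1..n}) :
  (nu <= mu)%MM -> nu != mu -> (mdeg nu < mdeg mu)%N.
Proof.
move=> nu_mu; apply: contraNltn => mdeg_le; apply/eqP.
rewrite -(submK nu_mu) mdegD -[X in (_ <= X)%N]add0n leq_add2r leqn0 in mdeg_le.
rewrite mdeg_eq0 in mdeg_le.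
by rewrite -[RHS](submK nu_mu) (eqP mdeg_le) add0m.
Qed.

Lemma eq_mcoeffM (p p' q q' : {mpoly F[n]}) mu :
  (forall nu, (nu <= mu)%MM -> p@_nu = p'@_nu) ->
  (forall nu, (nu <= mu)%MM -> q@_nu = q'@_nu) -> (p * q)@_mu = (p' * q')@_mu.
Proof.
move=> eqp eqq; rewrite !mcoeffM.
apply: eq_bigr => -[[a a_mu] [b b_mu]] /= {a_mu b_mu} /eqP muE.
by rewrite eqp ?eqq // muE ?lem_addl ?lem_addr.
Qed.

(** Each factor has a zero constant term, hence contributes at least one degree. *)
Lemma mcoeff_prod_small (X : 'I_n -> {mpoly F[n]}) s mu :
  (forall i, (X i)@_0%MM = 0) -> (mdeg mu < size s)%N ->
  (\prod_(i <- s) X i)@_mu = 0.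
Proof.
move=> X0; elim: s mu => // i s IHs mu /= mu_s.
rewrite big_cons mcoeffM big1 // => -[[a a_mu] [b b_mu]] /= {a_mu b_mu} /eqP muE.
case: (eqVneq a 0%MM) => [->|a_neq0]; first by rewrite X0 mul0r.
rewrite IHs ?mulr0 // -ltnS; apply: leq_trans mu_s.
by rewrite muE mdegD !ltnS -[X in (X < _)%N]add0n ltn_add2r lt0n mdeg_eq0.
Qed.

Lemma eq_mcoeff_prod (X X' : 'I_n -> {mpoly F[n]}) s mu :
  (forall i nu, (nu <= mu)%MM -> (X i)@_nu = (X' i)@_nu) ->
  (\prod_(i <- s) X i)@_mu = (\prod_(i <- s) X' i)@_mu.
Proof.
elim: s mu => [|i s IHs] mu eqX; first by rewrite !big_nil.
rewrite !big_cons; apply: eq_mcoeffM => [nu|nu nu_mu]; first exact: eqX.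
by apply: IHs => j la la_nu; apply: eqX; apply: lepm_trans nu_mu.
Qed.

(** In a product of at least two factors without constant term, every factor
    contributes to the coefficient of [mu] only through monomials strictly
    below [mu].  This is what makes the recursion on coefficients well
    founded. *)
Lemma eq_mcoeff_prod_below (X X' : 'I_n -> {mpoly F[n]}) s mu :
  (forall i, (X i)@_0%MM = 0) -> (forall i, (X' i)@_0%MM = 0) ->
  (forall i nu, (nu <= mu)%MM -> nu != mu -> (X i)@_nu = (X' i)@_nu) ->
  (1 < size s)%N ->
  (\prod_(i <- s) X i)@_mu = (\prod_(i <- s) X' i)@_mu.
Proof.
case: s => [//|i [//|j s]] X0 X'0 eqX _; rewrite 2!(big_cons _ _ i) !mcoeffM.
set r := j :: s.
apply: eq_bigr => -[[a a_mu] [b b_mu]] /= {a_mu b_mu} /eqP muE.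
have [->|a_neq0] := eqVneq a 0%MM; first by rewrite X0 X'0 !mul0r.
have [->|b_neq0] := eqVneq b 0%MM.
  by rewrite !mcoeff_prod_small ?mdeg0 // !mulr0.
rewrite eqX ?muE ?lem_addr //; last first.
  by rewrite -{1}[a]addm0 eqm_add2l eq_sym.
congr (_ * _); apply: eq_mcoeff_prod => h nu nu_b.
apply: eqX; first by rewrite muE; apply: lepm_trans nu_b (lem_addl _ _).
apply: contraNneq a_neq0 => nuE; rewrite -mdeg_eq0 -leqn0.
have: (mdeg nu <= mdeg b)%N by rewrite -(submK nu_b) mdegD leq_addl.
by rewrite nuE muE mdegD -{2}[mdeg b]add0n leq_add2r.
Qed.

(** The truncation order of the Taylor polynomial does not matter once it reaches
    the degree of [mu]: longer products do not reach [mu]. *)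
Lemma eq_forcing (X X' : 'I_n -> {mpoly F[n]}) m m' mu :
  (forall i, (X i)@_0%MM = 0) -> (forall i, (X' i)@_0%MM = 0) ->
  (forall i nu, (nu <= mu)%MM -> nu != mu -> (X i)@_nu = (X' i)@_nu) ->
  (mdeg mu <= m)%N -> (mdeg mu <= m')%N ->
  forcing m X mu = forcing m' X' mu.
Proof.
move=> X0 X'0 eqX mu_m mu_m'.
suff forcingE l Y : (forall i, (Y i)@_0%MM = 0) -> (mdeg mu <= l)%N ->
    forcing l Y mu = \row_j \sum_(2 <= k < (mdeg mu).+1) \sum_(s : k.-tuple 'I_n)
      T s 0 j * (\prod_(i <- s) Y i)@_mu.
  rewrite !forcingE //; apply/rowP => j; rewrite !mxE big_nat_cond [RHS]big_nat_cond.
  apply: eq_bigr => k /[!andbT] /andP[k_gt1 _]; apply: eq_bigr => s _.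
  by congr (_ * _); apply: eq_mcoeff_prod_below; rewrite ?size_tuple.
move=> Y0 mu_l; apply/rowP => j; rewrite !mxE raddf_sum /=.
rewrite [RHS]big_nat_cond [RHS](big_nat_widen _ _ l.+1) // [LHS]big_nat_cond.
rewrite [RHS]big_mkcond [LHS]big_mkcond /=; apply: eq_bigr => k _.
rewrite !andbT; have [/andP[k_gt1 k_l]|k_out] := boolP (1 < k < l.+1)%N; last first.
  case: ifPn => // /andP[/andP[k_gt1 k_mu] _].
  by case/negP: k_out; rewrite k_gt1 (leq_trans k_mu).
rewrite k_gt1 andbb raddf_sum /=.
case: ifPn => [_|]; first by apply: eq_bigr => s _; rewrite mcoeffZ.
rewrite -leqNgt => mu_k; rewrite big1 // => s _.
by rewrite mcoeffZ mcoeff_prod_small ?mulr0 // size_tuple.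
Qed.

Lemma mcoeff0_truncation D m i : (truncation m (formal_coef D) i)@_0%MM = 0.
Proof. by rewrite mcoeff_truncation mdeg0 formal_coef0 mxE. Qed.

(** The recursion with the full truncation at any order [m >= mdeg mu], in place of
    the truncation just below [mu]: one polynomial then serves for all the
    coefficients of degree at most [m]. *)
Lemma formal_coef_forcing D mu m : (1 < mdeg mu)%N -> (mdeg mu <= m)%N ->
  formal_coef D mu = forcing m (truncation m (formal_coef D)) mu *m G mu.
Proof.
move=> mu_gt1 mu_m; rewrite formal_coefE leqNgt mu_gt1; congr (_ *m _).
apply: (eq_forcing _ _ _ (leqnn _) mu_m); try exact: mcoeff0_truncation.
move=> i nu nu_mu nu_neq.
have nu_lt := mdeg_ltm nu_mu nu_neq.
rewrite !mcoeff_truncation -ltnS prednK ?(ltnW mu_gt1) // nu_lt.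
by rewrite (leq_trans (ltnW nu_lt)).
Qed.

(** If [mu] only involves the first variables, so does every monomial below [mu],
    and the recursion for [mu] never meets the other [D j]. *)
Lemma formal_coef_triangular (i : 'I_n) D D' (mu : 'X_{1..n}) :
  (forall j : 'I_n, (i < j)%N -> mu j = 0%N) ->
  (forall j : 'I_n, (j <= i)%N -> D j = D' j) -> formal_coef D mu = formal_coef D' mu.
Proof.
move=> + eqD; have [k] := ubnP (mdeg mu); elim: k mu => // k IHk mu.
rewrite ltnS => mu_k mu0.
have [mu_le1|mu_gt1] := leqP (mdeg mu) 1.
  rewrite !formal_coefE mu_le1; apply: eq_bigr => j _.
  by have [ji|ij] := leqP j i; [rewrite eqD | rewrite mu0 // !scale0r].
rewrite (formal_coef_forcing D mu_gt1 (leqnn _)) (formal_coef_forcing D' mu_gt1 (leqnn _)).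
apply: (congr1 (mulmx^~ (G mu))).
apply: (eq_forcing _ _ _ (leqnn _) (leqnn _)) => [j|j|].
- exact: mcoeff0_truncation.
- exact: mcoeff0_truncation.
move=> j nu nu_mu nu_neq; rewrite !mcoeff_truncation; case: ifP => // nu_le.
rewrite IHk //.
  exact: leq_trans (mdeg_ltm nu_mu nu_neq) mu_k.
move=> h /mu0 muh; apply/eqP; rewrite -leqn0 -muh.
exact/(mnm_lepP nu_mu).
Qed.

Lemma meval_truncation m c j (z : 'I_n -> F) : (truncation m c j).@[z] =
  \sum_(mu : 'X_{1..n < m.+1}) c mu 0 j * \prod_i z i ^+ mu i.
Proof.
by rewrite raddf_sum; apply: eq_bigr => mu _; rewrite /= mevalZ mevalX.
Qed.

Lemma meval_substitute m X j (z : 'I_n -> F) : (substitute m X j).@[z] =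
  \sum_(2 <= k < m.+1) \sum_(s : k.-tuple 'I_n)
    T s 0 j * \prod_(i <- s) (X i).@[z].
Proof.
rewrite raddf_sum; apply: eq_bigr => k _; rewrite raddf_sum.
by apply: eq_bigr => s _; rewrite /= mevalZ rmorph_prod.
Qed.

Lemma meval_forcing m X : exists2 M, (m <= M)%N & forall z j,
  (substitute m X j).@[z] =
  \sum_(mu : 'X_{1..n < M.+1}) forcing m X mu 0 j * \prod_i z i ^+ mu i.
Proof.
pose M := maxn m (\max_(j < n) msize (substitute m X j)).
exists M; first exact: leq_maxl.
move=> z j; rewrite {1}(@mpolywE _ _ M.+1 (substitute m X j)).
  by rewrite raddf_sum; apply: eq_bigr => mu _; rewrite /= mevalZ mevalX mxE.
apply/leqW; rewrite leq_max; apply/orP; right.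
exact: (leq_bigmax (F := fun j => msize (substitute m X j))).
Qed.

Lemma forcing_low D m mu : (mdeg mu <= 1)%N ->
  forcing m (truncation m (formal_coef D)) mu = 0.
Proof.
move=> mu_le1; apply/rowP => j; rewrite !mxE raddf_sum big_nat_cond big1 // => k.
rewrite andbT => /andP[k_gt1 _]; rewrite raddf_sum big1 // => s _.
rewrite /= mcoeffZ mcoeff_prod_small ?mulr0 ?size_tuple ?(leq_ltn_trans mu_le1) //.
exact: mcoeff0_truncation.
Qed.
End Coefficients.

Section MultiIndex.
Variable n : nat.

Definition index_of (mu : 'X_{1..n}) : multi_index n := [ffun i => mu i].

Definition monomial_of (chi : multi_index n) : 'X_{1..n} :=
  [multinom chi i | i < n].

Lemma index_ofK : cancel index_of monomial_of.
Proof. by move=> mu; apply/mnmP => i; rewrite mnmE ffunE. Qed.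

Lemma monomial_ofK : cancel monomial_of index_of.
Proof. by move=> chi; apply/ffunP => i; rewrite ffunE mnmE. Qed.

Definition degree (chi : multi_index n) : nat := \sum_(i < n) chi i.

Lemma mdeg_monomial_of chi : mdeg (monomial_of chi) = degree chi.
Proof. by rewrite mdegE; apply: eq_bigr => i _; rewrite mnmE. Qed.

Definition indices (m : nat) : seq (multi_index n) :=
  [seq index_of mu | mu : 'X_{1..n < m.+1}].

Lemma mem_indices m chi : (chi \in indices m) = (degree chi <= m)%N.
Proof.
apply/mapP/idP => [[mu _ ->]|chi_m].
  by rewrite -mdeg_monomial_of index_ofK -ltnS bmdeg.
have chi_m' : (mdeg (monomial_of chi) < m.+1)%N by rewrite mdeg_monomial_of ltnS.
by exists (BMultinom chi_m'); rewrite ?mem_enum ?monomial_ofK.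
Qed.

Lemma indices_uniq m : uniq (indices m).
Proof.
rewrite map_inj_uniq ?enum_uniq // => mu nu /(can_inj index_ofK).
exact: val_inj.
Qed.

Lemma sum_indices (V : nmodType) m (f : 'X_{1..n} -> V) :
  \sum_(mu : 'X_{1..n < m.+1}) f mu =
  \sum_(chi <- indices m) f (monomial_of chi).
Proof.
by rewrite big_map big_enum; apply: eq_bigr => mu _; rewrite index_ofK.
Qed.
End MultiIndex.

(** The polynomial part of the expansion, in a form free of polynomials: after
    substitution of the truncation at degree [m] in the Taylor polynomial, the
    terms of degree at most [m] are those of the linear part, as expressed by
    [h], and all the others have a degree between [m + 1] and some [M]. *)
Theorem formal_solution (F : comNzRingType) (n : nat)
    (T : seq 'I_n -> 'rV[F]_n) (G : multi_index n -> 'M[F]_n) :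
  exists c : multi_index n -> ('I_n -> 'rV[F]_n) -> 'rV[F]_n,
  [/\ forall D, c [ffun=> 0%N] D = 0,
      forall i D, c (unit_index i) D = D i,
      forall (i : 'I_n) (chi : multi_index n),
        (forall j : 'I_n, (i < j)%N -> chi j = 0%N) ->
        forall D D' : 'I_n -> 'rV[F]_n,
          (forall j : 'I_n, (j <= i)%N -> D j = D' j) -> c chi D = c chi D'
    & forall D m, exists M h,
      [/\ (m <= M)%N,
          forall chi, (degree chi <= 1)%N -> h chi = 0,
          forall chi, (1 < degree chi <= m)%N -> c chi D = h chi *m G chi
        & forall (z : 'I_n -> F) j,
          \sum_(2 <= k < m.+1) \sum_(s : k.-tuple 'I_n) T s 0 j *
            \prod_(i <- s)
              \sum_(chi <- indices n m) c chi D 0 i * \prod_l z l ^+ chi l =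
          \sum_(chi <- indices n M) h chi 0 j * \prod_l z l ^+ chi l]].
Proof.
pose G' mu := G (index_of mu).
exists (fun chi D => formal_coef T G' D (monomial_of chi)); split.
- move=> D; rewrite (_ : monomial_of _ = 0%MM) ?formal_coef0 //.
  by apply/mnmP => i; rewrite mnmE ffunE mnm0E.
- move=> i D; rewrite (_ : monomial_of _ = U_(i)%MM) ?formal_coefU //.
  by apply/mnmP => j; rewrite mnmE ffunE mnm1E eq_sym.
- move=> i chi chi0 D D' eqD; apply: (@formal_coef_triangular _ _ _ _ i) => // j /chi0.
  by rewrite mnmE.
move=> D m; have [M mM forcingE] := meval_forcing T m (truncation m (formal_coef T G' D)).
exists M, (fun chi => forcing T m (truncation m (formal_coef T G' D)) (monomial_of chi)).
split => //.
- by move=> chi chi1; apply: forcing_low; rewrite mdeg_monomial_of.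
- move=> chi /andP[chi_gt1 chi_m].
  by rewrite (@formal_coef_forcing _ _ _ _ _ _ m) ?mdeg_monomial_of // /G' monomial_ofK.
move=> z j; have := forcingE z j; rewrite meval_substitute.
rewrite (sum_indices _ (fun mu => forcing T m _ mu 0 j * \prod_i z i ^+ mu i)) => forcingE'.
transitivity (\sum_(2 <= k < m.+1) \sum_(s : k.-tuple 'I_n) T s 0 j *
   \prod_(i <- s) (truncation m (formal_coef T G' D) i).@[z]).
  apply: eq_bigr => k _; apply: eq_bigr => s _; congr (_ * _).
  apply: eq_bigr => i _.
  rewrite meval_truncation.
  rewrite (sum_indices _ (fun mu =>
    formal_coef T G' D mu 0 i * \prod_l z l ^+ mu l)).
  apply: eq_bigr => chi _; congr (_ * _).
  by apply: eq_bigr => l _; rewrite mnmE.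
rewrite forcingE'; apply: eq_bigr => chi _; congr (_ * _).
by apply: eq_bigr => l _; rewrite mnmE.
Qed.
End FormalSolution.

From mathcomp Require Import all_classical all_reals all_analysis.
From mathcomp Require Import zify ring lra.

Import Order.TTheory GRing.Theory Num.Theory.
Import numFieldNormedType.Exports.
Import FormalSolution.

Local Open Scope classical_set_scope.
Local Open Scope ring_scope.

(** * Mean value estimates in several variables *)

Section RowNorm.
Context {R : realType} {n : nat}.
Implicit Type v : 'rV[R]_n.

Lemma rV_norm_ge v j : `|v 0 j| <= `|v|.
Proof.
rewrite [leRHS]/Num.Def.normr/= mx_normrE.
exact: (le_bigmax (0 : R) (fun i : 'I_1 * 'I_n => `|v i.1 i.2|) (0, j)).
Qed.

Lemma rV_norm_le v (e : R) : 0 <= e -> (forall j, `|v 0 j| <= e) -> `|v| <= e.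
Proof.
move=> e0 ve; rewrite [leLHS]/Num.Def.normr/= mx_normrE.
by apply: bigmax_le => // -[i j] _; rewrite ord1.
Qed.
End RowNorm.

Lemma mean_value (R : realType) (f df : R -> R) (a b : R) : a <= b ->
  (forall u : R, a <= u <= b -> is_derive u 1 f (df u)) ->
  exists2 c, a <= c <= b & f b - f a = df c * (b - a).
Proof.
move=> ab dff.
have [||c] := @MVT_segment R f df a b ab; last by rewrite in_itv /=; exists c.
  by move=> u; rewrite in_itv /= => /andP[au ub]; apply: dff; rewrite !ltW.
apply: derivable_within_continuous => u; rewrite in_itv /= => abu.
by have [] := dff u abu.
Qed.

Lemma mean_value0 (R : realType) (f df : R -> R) (a : R) :
  (forall u : R, is_derive u 1 f (df u)) ->
  exists2 c, `|c| <= `|a| & f a - f 0 = df c * a.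
Proof.
move=> dff; have [a0|/ltW a0] := leP 0 a.
  have [c /andP[c0 ca] ->] := mean_value a0 (fun u _ => dff u).
  by exists c; rewrite ?subr0 // !ger0_norm // (le_trans c0).
have [c /andP[ca c0]] := mean_value a0 (fun u _ => dff u).
rewrite sub0r mulrN => fE; exists c; first by rewrite !ler0_norm // lerN2.
by rewrite -[df c * a]opprK -fE opprB.
Qed.

Lemma is_derive_line (R : realType) (V W : normedModType R) (f : V -> W)
    (p v : V) (u : R) : derivable f (p + u *: v) v ->
  is_derive u 1 (fun u : R => f (p + u *: v)) ('D_v f (p + u *: v)).
Proof.
move=> df.
have E : (fun h : R => h^-1 *: (f (p + (h *: 1 + u) *: v) - f (p + u *: v))) =
         (fun h : R => h^-1 *: (f (h *: v + (p + u *: v)) - f (p + u *: v))).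
  apply/funext => h; congr (_ *: (f _ - _)).
  by rewrite scalerDl addrCA; congr (_ *: _ + _); rewrite /GRing.scale /= mulr1.
by apply: DeriveDef; rewrite /derivable /derive /= ?E.
Qed.

Section Increment.
Context {R : realType} {n : nat}.
Local Notation e i := (delta_mx 0 i : 'rV[R]_n).

(** Change the coordinates of [q] one at a time and apply the mean value theorem to
    each change.  The intermediate points stay in the cube of radius [`|v|]
    around [q]. *)
Lemma increment (F : 'rV[R]_n -> R) (q v : 'rV[R]_n) :
  (forall i p, derivable F p (e i)) ->
  exists xi : 'I_n -> 'rV[R]_n, (forall i, `|xi i - q| <= `|v|) /\
    F (q + v) - F q = \sum_i v 0 i * 'D_(e i) F (xi i).
Proof.
move=> dF.
suff: forall k, (k <= n)%N -> forall v : 'rV[R]_n,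
    (forall i : 'I_n, (k <= i)%N -> v 0 i = 0) ->
    exists xi : 'I_n -> 'rV[R]_n, (forall i, `|xi i - q| <= `|v|) /\
      F (q + v) - F q = \sum_i v 0 i * 'D_(e i) F (xi i).
  apply; first exact: leqnn.
  by move=> i; rewrite leqNgt ltn_ord.
elim=> [_|k IHk kn] {}v v0.
  have -> : v = 0 by apply/rowP => i; rewrite v0 // mxE.
  exists (fun=> q); split=> [i|]; first by rewrite subrr normr0.
  by rewrite addr0 subrr big1 // => i _; rewrite mxE mul0r.
(* [v'] is [v] with its last nonzero coordinate removed *)
pose i0 := Ordinal kn; pose v' := v - v 0 i0 *: e i0.
have v'E i : v' 0 i = if i == i0 then 0 else v 0 i.
  rewrite !mxE eqxx /= ; case: eqVneq => [->|_]; first by rewrite mulr1 subrr.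
  by rewrite mulr0 subr0.
have [|xi [xi_q xiE]] := IHk (ltnW kn) v'.
  move=> i ki; rewrite v'E; case: eqVneq => // i_neq; apply: v0.
  rewrite ltn_neqAle ki andbT; apply: contraNneq i_neq => kE.
  exact/eqP/val_inj.
have v'_v : `|v'| <= `|v|.
  apply: rV_norm_le => // i; rewrite v'E; case: ifP => _; first by rewrite normr0.
  exact: rV_norm_ge.
have [c c_v] := @mean_value0 R (fun u => F (q + v' + u *: e i0)) _ (v 0 i0)
  (fun u => is_derive_line (dF i0 _)).
rewrite scale0r addr0 => cE.
exists (fun i => if i == i0 then q + v' + c *: e i0 else xi i); split=> [i|].
  case: ifP => _; last exact: le_trans v'_v.
  have -> : q + v' + c *: e i0 - q = v' + c *: e i0.
    by rewrite -[q + v' + _]addrA [q + _]addrC addrK.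
  apply: rV_norm_le => // j.
  rewrite mxE v'E !mxE eqxx /=; case: eqP => _.
    by rewrite add0r mulr1 (le_trans c_v) // rV_norm_ge.
  by rewrite mulr0 addr0 rV_norm_ge.
have -> : q + v = q + v' + v 0 i0 *: e i0 by rewrite -addrA subrK.
rewrite -(subrKA (F (q + v'))) cE xiE [RHS](bigD1 i0) //= eqxx mulrC; congr (_ + _).
rewrite (bigD1 i0) //= v'E eqxx mul0r add0r; apply: eq_bigr => i /negPf i_neq.
by rewrite v'E i_neq.
Qed.
End Increment.

Section Smooth.
Context {R : realType} {n : nat}.
Local Notation e i := (delta_mx 0 i : 'rV[R]_n).
Implicit Types f : 'rV[R]_n -> 'rV[R]_n.

Lemma bounded_on_ball (V : normedModType R) (f : 'rV[R]_n -> V) (r : R) : continuous f ->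
  exists2 C, 0 <= C & forall x, `|x| <= r -> `|f x| <= C.
Proof.
move=> fc; pose A := [set x : 'rV[R]_n | `|x| <= r].
have cA : compact A.
  apply: bounded_closed_compact.
    exists r; split=> [|M rM x Ax]; first exact: num_real.
    exact: le_trans (ltW rM).
  apply: (@closed_comp _ _ (fun x : 'rV[R]_n => `|x|) [set y | y <= r]).
    by move=> x _; exact: norm_continuous.
  exact: closed_le.
have /compact_bounded[M [Mreal Mle]] : compact (f @` A).
  by apply: continuous_compact => //; apply: continuous_subspaceT.
exists (`|M| + 1) => [|x xr]; first by rewrite addr_ge0.
by apply: (Mle (`|M| + 1)) => /=; [rewrite ltr_pwDr ?ler_norm | exists x].
Qed.

Lemma derivable_coord f p v j : derivable f p v ->
  derivable (fun x => f x 0 j) p v.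
Proof. by move=> /derivable_mxP. Qed.

Lemma derive_coord f p v j : derivable f p v ->
  'D_v (fun x => f x 0 j) p = ('D_v f p) 0 j.
Proof. by move=> df; rewrite derive_mx // mxE. Qed.

Lemma smooth_continuous f : smooth f -> continuous f.
Proof. by move=> sf; have [] := sf [::]. Qed.

Lemma smooth_derivable f p i : smooth f -> derivable f p (e i).
Proof. by move=> sf; have [_] := sf [::]; apply. Qed.

Lemma smooth_derive f i : smooth f -> smooth ('D_(e i) f).
Proof. by move=> sf s; exact: (sf (i :: s)). Qed.

Lemma increment_rV f q v j : smooth f ->
  exists xi : 'I_n -> 'rV[R]_n, (forall i, `|xi i - q| <= `|v|) /\
    (f (q + v) - f q) 0 j = \sum_i v 0 i * ('D_(e i) f (xi i)) 0 j.
Proof.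
move=> sf; have [|xi [xi_q xiE]] := @increment R n (fun x => f x 0 j) q v.
  by move=> i p; exact/derivable_coord/smooth_derivable.
exists xi; split=> //; rewrite !mxE xiE; apply: eq_bigr => i _.
by rewrite derive_coord //; exact: smooth_derivable.
Qed.

Lemma lipschitz_bound f (r B : R) : smooth f -> 0 <= B ->
  (forall i p, `|p| <= r -> `|'D_(e i) f p| <= B) ->
  forall x y, `|y| + `|x - y| <= r -> `|f x - f y| <= n%:R * B * `|x - y|.
Proof.
move=> sf B0 fB x y xyr; apply: rV_norm_le => [|j]; first by rewrite !mulr_ge0.
have [xi [xi_y]] := increment_rV y (x - y) j sf.
rewrite [y + _]addrC subrK => ->; apply: le_trans (ler_norm_sum _ _ _) _.
rewrite -mulrA mulr_natl -[X in _ *+ X](card_ord n) -sumr_const.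
apply: ler_sum => i _; rewrite normrM mulrC ler_pM // ?rV_norm_ge //.
apply: le_trans (rV_norm_ge _ _) _; apply/fB/(le_trans _ xyr).
by rewrite -[xi i](subrK y) addrC (le_trans (ler_normD _ _)) // lerD2l.
Qed.

(** Continuous partial derivatives give differentiability: in [increment_rV] the
    intermediate points tend to [q]. *)
Lemma smooth_differentiable f q : smooth f ->
  differentiable f q /\ forall v, 'D_v f q = \sum_i v 0 i *: 'D_(e i) f q.
Proof.
move=> sf; pose A := \matrix_(i < n) 'D_(e i) f q.
have AE v : v *m A = \sum_i v 0 i *: 'D_(e i) f q.
  by rewrite mulmx_sum_row; apply: eq_bigr => i _; rewrite rowK.
pose df : {linear 'rV[R]_n -> 'rV[R]_n} := mulmxr A.
have dfc : continuous df.
  rewrite (_ : (df : _ -> _) = \sum_i (fun v : 'rV_n => v 0 i *: 'D_(e i) f q)).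
    move=> v; apply: differentiable_continuous; apply: differentiable_sum => i.
    exact/differentiableZl/differentiable_coord.
  by apply/funext => v; rewrite fct_sumE /= AE.
have fE : f \o shift q = cst (f q) + df +o_ 0 id.
  apply/eqaddoP => eps eps0.
  have n_gt0 : 0 < n.+1%:R :> R by rewrite ltr0n.
  have [d d0 dE] : exists2 d : R, 0 < d & forall p, `|p - q| < d -> forall i,
      `|'D_(e i) f p - 'D_(e i) f q| <= eps / n.+1%:R.
    have : \forall p \near q, forall i,
        `|'D_(e i) f q - 'D_(e i) f p| <= eps / n.+1%:R.
      apply: (@filter_forall _ _
        (fun i p => `|'D_(e i) f q - 'D_(e i) f p| <= eps / n.+1%:R)
        _ (nbhs_filter q)) => i.
      have /cvgrPdist_le := @smooth_continuous _ (smooth_derive i sf) q.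
      by apply; rewrite divr_gt0.
    move=> /nbhs_normP[d /= d0 dE]; exists d => // p pd i.
    by rewrite distrC; apply: dE; rewrite /= distrC.
  have nd := @nbhs0_lt R 'rV[R]_n d d0.
  apply: filterS nd => v /= vd.
  apply: rV_norm_le => [|j]; first by rewrite mulr_ge0 // ltW.
  have [xi [xi_q xiE]] := increment_rV q v j sf.
  have -> : ((f \o shift q) - (cst (f q) + df)) v = f (q + v) - f q - v *m A.
    by rewrite !fctE /= opprD addrA [v + q]addrC.
  rewrite mxE xiE AE mxE summxE -sumrB.
  apply: le_trans (ler_norm_sum _ _ _) _.
  apply: (@le_trans _ _ (\sum_(i < n) eps / n.+1%:R * `|v|)).
    apply: ler_sum => i _; rewrite mxE -mulrBr normrM mulrC.
    apply: ler_pM; rewrite ?rV_norm_ge //.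
    have := dE (xi i) (le_lt_trans (xi_q i) vd) i; apply: le_trans.
    by have := rV_norm_ge ('D_(e i) f (xi i) - 'D_(e i) f q) j; rewrite !mxE.
  rewrite sumr_const card_ord -[leLHS]mulr_natl mulrA ler_wpM2r // mulrCA.
  rewrite ler_piMr ?ltW // ltr_pdivrMr // mul1r ltr_nat //.
have dE := diff_unique dfc fE.
have fdiff : differentiable f q.
  by apply/diff_locallyP; rewrite dE; split.
by split => // v; rewrite deriveE // dE /= AE.
Qed.
End Smooth.

(** * Taylor's formula *)

Section Taylor.
Context {R : realType} {n : nat}.
Local Notation e i := (delta_mx 0 i : 'rV[R]_n).
Implicit Types f : 'rV[R]_n -> 'rV[R]_n.

Lemma derive_jacobian0 f (v : 'rV[R]_n) : smooth f -> 'J f 0 = 0 -> 'D_v f 0 = 0.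
Proof.
move=> sf J0; have [df _] := smooth_differentiable 0 sf.
by rewrite deriveEjacobian // J0 mulmx0.
Qed.

Lemma is_derive_ray f (x : 'rV[R]_n) j (u : R) : smooth f ->
  is_derive u 1 (fun u : R => f (u *: x) 0 j)
    (\sum_i x 0 i * ('D_(e i) f (u *: x)) 0 j).
Proof.
move=> sf; have [df dfE] := smooth_differentiable (0 + u *: x) sf.
have dxf := @diff_derivable R _ _ f (0 + u *: x) x df.
have [dl lE] := is_derive_line dxf.
have lf : (fun u : R => f (0 + u *: x)) = (fun u : R => f (u *: x)).
  by apply/funext => w; rewrite add0r.
rewrite lf in dl lE.
apply: DeriveDef; first by move/derivable_mxP: dl.
have /(congr1 (fun v : 'rV_n => v 0 j)) := lE; rewrite derive_mx // mxE => ->.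
by rewrite dfE add0r summxE; apply: eq_bigr => i _; rewrite mxE.
Qed.

(** The homogeneous Taylor term of degree [k], as a sum over words of length [k]. *)
Definition taylor_term f (x : 'rV[R]_n) (k : nat) : 'rV[R]_n :=
  (k`!%:R)^-1 *:
    \sum_(s : k.-tuple 'I_n) (\prod_(i <- s) x 0 i) *: partials s f 0.

Definition taylor f (m : nat) (x : 'rV[R]_n) : 'rV[R]_n :=
  \sum_(k < m) taylor_term f x k.

Lemma taylor_termZ f (u : R) x k :
  taylor_term f (u *: x) k = u ^+ k *: taylor_term f x k.
Proof.
rewrite /taylor_term scalerA mulrC -scalerA; congr (_ *: _); rewrite scaler_sumr.
have prodE (l : seq 'I_n) :
    \prod_(i <- l) (u *: x) 0 i = u ^+ size l * \prod_(i <- l) x 0 i.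
  elim: l => [|i l IHl]; first by rewrite !big_nil mul1r.
  by rewrite !big_cons IHl mxE exprS mulrACA.
by apply: eq_bigr => s _; rewrite scalerA prodE size_tuple.
Qed.

(** Splitting off the first letter of a word: this is the derivative of the Taylor
    polynomial along a ray, which drives the induction in
    [taylor_remainder]. *)
Lemma taylor_termS f x k : k.+1%:R *: taylor_term f x k.+1 =
  \sum_i x 0 i *: taylor_term ('D_(e i) f) x k.
Proof.
rewrite /taylor_term scalerA factS natrM invfM mulrA divff ?mul1r ?pnatr_eq0 //.
under [RHS]eq_bigr => i _ do rewrite scalerA mulrC -scalerA scaler_sumr.
rewrite -scaler_sumr; congr (_ *: _); rewrite pair_big /=.
rewrite (reindex (fun p : 'I_n * k.-tuple 'I_n => [tuple of p.1 :: p.2])) /=.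
  apply: eq_bigr => -[i s] _ /=; rewrite scalerA; congr (_ *: _).
  by rewrite big_cons.
exists (fun s : k.+1.-tuple 'I_n => (thead s, [tuple of behead s])).
  by move=> [i s] _; congr (_, _); apply/val_inj.
by move=> s _; rewrite [s]tuple_eta; apply/val_inj.
Qed.

Lemma taylor_term0 f x : taylor_term f x 0 = f 0.
Proof.
rewrite /taylor_term fact0 invr1 scale1r (bigD1 [tuple]) //= [X in _ + X]big1; last first.
  by move=> s; rewrite (tuple0 s).
by rewrite big_nil scale1r addr0.
Qed.

(** By induction on [m]: along the ray [u *: x] the derivative of the remainder is
    the combination, with coefficients [x 0 i], of the remainders of order [m]
    of the partial derivatives of [f]. *)
Lemma taylor_remainder f m : smooth f -> exists2 C, 0 <= C &
  forall x, `|x| <= 1 -> `|f x - taylor f m x| <= C * `|x| ^+ m.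
Proof.
elim: m f => [|m IHm] f sf.
  have [C C0 fC] := bounded_on_ball 1 (smooth_continuous sf).
  by exists C => // x /fC; rewrite /taylor big_ord0 subr0 expr0 mulr1.
have /(_ _)/cid2-/all_sig2[C C0 fC] := fun i => IHm _ (smooth_derive i sf).
exists (\sum_i C i) => [|x x1]; first exact: sumr_ge0.
apply: rV_norm_le => [|j].
  by apply: mulr_ge0; [exact: sumr_ge0 | exact: exprn_ge0].
pose P := \poly_(k < m.+1) (taylor_term f x k 0 j).
have PE u : P.[u] = (taylor f m.+1 (u *: x)) 0 j.
  rewrite horner_poly summxE; apply: eq_bigr => k _.
  by rewrite taylor_termZ [RHS]mxE mulrC.
have dPE u : P^`().[u] = \sum_i x 0 i * (taylor ('D_(e i) f) m (u *: x)) 0 j.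
  rewrite (_ : P^`() = \poly_(k < m) (k.+1%:R * taylor_term f x k.+1 0 j)).
    rewrite horner_poly; under [RHS]eq_bigr => i _ do rewrite summxE mulr_sumr.
    rewrite exchange_big; apply: eq_bigr => k _ /=.
    under [RHS]eq_bigr => i _ do rewrite taylor_termZ mxE mulrCA.
    rewrite -mulr_sumr mulrC; congr (_ * _).
    have /(congr1 (fun v : 'rV_n => v 0 j)) := taylor_termS f x k.
    by rewrite mxE summxE => ->; apply: eq_bigr => i _; rewrite mxE.
  apply/polyP => k; rewrite coef_deriv !coef_poly ltnS; case: ifP => _.
    by rewrite mulr_natl.
  by rewrite mul0rn.
pose g u := f (u *: x) 0 j - P.[u].
pose dg u := \sum_i x 0 i *
  ('D_(e i) f (u *: x) - taylor ('D_(e i) f) m (u *: x)) 0 j.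
have dgE (u : R) : 0 <= u <= 1 -> is_derive u 1 g (dg u).
  move=> _; have [d1 E1] := is_derive_ray x j u sf.
  have d2 : derivable (horner P) u 1 by exact: derivable_horner.
  apply: DeriveDef; first exact: derivableB.
  rewrite deriveB // E1 -derive1E -derivE dPE -sumrB; apply: eq_bigr => i _.
  by rewrite !mxE mulrBr.
have [c /andP[c0 c1]] := mean_value ler01 dgE.
have taylor0 : taylor f m.+1 0 = f 0.
  rewrite /taylor big_ord_recl taylor_term0 big1 ?addr0 // => k _.
  have := taylor_termZ f 0 0 (lift ord0 k).
  by rewrite scale0r expr0n /= scale0r.
rewrite /g !PE scale0r scale1r taylor0 subrr !subr0 mulr1 => gE.
have -> : (f x - taylor f m.+1 x) 0 j = dg c by rewrite -gE !mxE.
rewrite exprS mulrA; apply: le_trans (ler_norm_sum _ _ _) _.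
rewrite mulrAC mulr_suml mulr_suml; apply: ler_sum => i _.
rewrite normrM [leRHS]mulrC; apply: ler_pM; rewrite ?rV_norm_ge //.
apply: le_trans (rV_norm_ge _ _) _; apply: le_trans (fC i _ _) _.
  by rewrite normrZ ger0_norm // mulr_ile1.
rewrite ler_wpM2l // lerXn2r ?nnegrE // normrZ ger0_norm //.
by rewrite ler_piMl.
Qed.
End Taylor.

(** * Exponential decay and scalar linear equations *)

Section Decay.
Context {R : realType}.
Implicit Types (f g h u : R -> R) (k K l t : R).

Definition bigO_exp k f : Prop :=
  exists C, \forall t \near +oo, `|f t| <= C * expR (- k * t).

(** Decay at every exponential rate below [K].  The open condition makes the rates
    additive, with no loss to keep track of, and removes the borderline case
    where the rate of the forcing term of a linear equation is the rate of the
    equation itself, which would produce a factor [t]. *)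
Definition decays K f : Prop := forall k, k < K -> bigO_exp k f.

Lemma near_pinfty_ex (P : R -> Prop) :
  (\forall t \near +oo, P t) <-> exists2 T, 0 < T & forall t, T <= t -> P t.
Proof.
split=> [[M [Mreal MP]]|[T T0 TP]].
  exists (`|M| + 1) => [|t Mt]; first by rewrite ltr_wpDl.
  by apply: MP; apply: lt_le_trans Mt; rewrite ltr_pwDr ?ler_norm.
by apply: filterS (nbhs_pinfty_ge (num_real T)) => t; exact: TP.
Qed.

Lemma decays_le K K' f : K' <= K -> decays K f -> decays K' f.
Proof. by move=> KK' fK k kK'; apply: fK; apply: lt_le_trans KK'. Qed.

Lemma decays_bound K C f g :
  (\forall t \near +oo, `|f t| <= C * `|g t|) -> decays K g -> decays K f.
Proof.
move=> fg gK k /gK[C' gC']; exists (`|C| * C'); near=> t.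
rewrite (le_trans (near fg t _)) // -mulrA.
apply: (@le_trans _ _ (`|C| * `|g t|)); first by rewrite ler_wpM2r ?ler_norm.
by rewrite ler_wpM2l // (near gC' t).
Unshelve. all: by end_near. Qed.

Lemma eq_decays K f g : (\forall t \near +oo, f t = g t) -> decays K g -> decays K f.
Proof.
move=> fg; apply: (@decays_bound _ 1).
by apply: filterS fg => t ->; rewrite mul1r.
Qed.

Lemma decaysD K f g : decays K f -> decays K g -> decays K (fun t => f t + g t).
Proof.
move=> fK gK k kK; have [C fC] := fK k kK; have [C' gC'] := gK k kK.
exists (C + C'); near=> t; rewrite mulrDl (le_trans (ler_normD _ _)) // lerD //.
  by near: t.
by near: t.
Unshelve. all: by end_near. Qed.

Lemma decaysZ K a f : decays K f -> decays K (fun t => a * f t).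
Proof.
apply: (@decays_bound _ `|a|); by apply: nearW => t; rewrite normrM.
Qed.

Lemma decaysB K f g : decays K f -> decays K g -> decays K (fun t => f t - g t).
Proof.
move=> fK gK; apply: (decaysD fK).
apply: eq_decays (decaysZ (-1) gK); by apply: nearW => t; rewrite mulN1r.
Qed.

Lemma decays0 K : decays K (fun=> 0).
Proof.
move=> k _; exists 0; apply: nearW => t; by rewrite normr0 mul0r.
Qed.

Lemma decays_sum K (I : Type) (r : seq I) (P : pred I) (f : I -> R -> R) :
  (forall i, P i -> decays K (f i)) ->
  decays K (fun t => \sum_(i <- r | P i) f i t).
Proof.
move=> fK; elim: r => [|i r IHr].
  by apply: eq_decays (@decays0 K); apply: nearW => t; rewrite big_nil.
case Pi: (P i).
  apply: eq_decays (decaysD (fK i Pi) IHr).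
  by apply: nearW => t; rewrite big_cons Pi.
by apply: eq_decays IHr; apply: nearW => t; rewrite big_cons Pi.
Qed.

Lemma decaysM K K' f g : decays K f -> decays K' g ->
  decays (K + K') (fun t => f t * g t).
Proof.
move=> fK gK' k kKK'; pose d := (K + K' - k) / 2.
have d0 : 0 < d by rewrite divr_gt0 // subr_gt0.
have kE : k = (K - d) + (K' - d) by rewrite /d; lra.
have [|C fC] := fK (K - d); first by rewrite ltrBlDr ltrDl.
have [|C' gC'] := gK' (K' - d); first by rewrite ltrBlDr ltrDl.
exists (C * C'); near=> t.
have -> : - k * t = - (K - d) * t + - (K' - d) * t by rewrite kE opprD mulrDl.
rewrite normrM expRD mulrACA ler_pM //.
  by near: t.
by near: t.
Unshelve. all: by end_near. Qed.

Lemma decays_exp K w : K <= w -> decays K (fun t => expR (- w * t)).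
Proof.
move=> Kw k kK; exists 1; near=> t.
rewrite mul1r ger0_norm ?expR_ge0 // ler_expR ler_wpM2r //.
by rewrite lerN2 (le_trans (ltW kK)).
Unshelve. all: by end_near. Qed.

Lemma decaysX K f m : decays K f -> decays (m%:R * K) (fun t => f t ^+ m).
Proof.
move=> fK; elim: m => [|m IHm].
  rewrite mul0r; apply: eq_decays (decays_exp (lexx 0)).
  by apply: nearW => t; rewrite expr0 oppr0 mul0r expR0.
rewrite -natr1 mulrDl mul1r addrC; apply: eq_decays (decaysM fK IHm).
by apply: nearW => t; rewrite exprS.
Qed.

Lemma decays_littleo K k f : decays K f -> k < K -> littleo_exp k f.
Proof.
move=> fK kK; pose d := (K - k) / 2.
have d0 : 0 < d by rewrite divr_gt0 // subr_gt0.
have [|C fC] := fK (k + d); first by rewrite /d; lra.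
have expd : C * expR (- (d * t)) @[t --> +oo] --> (0 : R).
  rewrite -[X in _ --> X](mulr0 C); apply: cvgMl_tmp.
  exact: (cvg_comp _ _ (gt0_cvgMry d0 (@cvg_id _ +oo)) (@cvgr_expR R)).
apply: norm_cvg0; apply: (squeeze_cvgr _ (cvg_cst 0) expd).
near=> t; rewrite normr_ge0 /= normrM [X in _ * X]ger0_norm ?expR_ge0 //.
have -> : - (d * t) = - (k + d) * t + k * t by lra.
by rewrite expRD mulrA ler_wpM2r ?expR_ge0 //; near: t.
Unshelve. all: by end_near. Qed.

Lemma is_derive_mul f g (df dg t : R) : is_derive t 1 f df -> is_derive t 1 g dg ->
  is_derive t 1 (fun t => f t * g t) (f t * dg + df * g t).
Proof.
move=> fd gd; apply: is_derive_eq (is_deriveM fd gd) _.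
by rewrite /GRing.scale /= [g t * _]mulrC.
Qed.

Lemma is_derive_expM (a t : R) :
  is_derive t 1 (fun t => expR (a * t)) (a * expR (a * t)).
Proof.
rewrite mulrC; apply: (is_derive1_comp (is_derive_expR _)).
have := is_derive_mul (is_derive_cst a t 1) (is_derive_id t 1).
by rewrite mulr1 mul0r addr0.
Qed.

Lemma derive_le0_nincr u (du : R -> R) T :
  (forall t, T <= t -> is_derive t 1 u (du t)) ->
  (forall t, T <= t -> du t <= 0) ->
  forall s t, T <= s -> s <= t -> u t <= u s.
Proof.
move=> uE du0 s t Ts st.
have [v /andP[sv vt]|c /andP[sc ct] /eqP] := @mean_value R u du s t st.
  by apply: uE; apply: le_trans sv.
rewrite subr_eq => /eqP ->; rewrite gerDr mulr_le0_ge0 ?subr_ge0 //.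
by apply: du0; apply: le_trans sc.
Qed.

(** Compare [u] and [- u] with the primitive [- C / k * expR (- k * t)] of the bound;
    [k] may have any sign. *)
Lemma derive_exp_bound u (du : R -> R) T C k : k != 0 ->
  (forall t, T <= t -> is_derive t 1 u (du t)) ->
  (forall t, T <= t -> `|du t| <= C * expR (- k * t)) ->
  forall s t, T <= s -> s <= t ->
    `|u t - u s| <= C / k * (expR (- k * s) - expR (- k * t)).
Proof.
move=> k0 uE duC s t Ts st.
have expE (v : R) : is_derive v 1 (fun v => C / k * expR (- k * v))
    (- (C * expR (- k * v))).
  have := is_derive_mul (is_derive_cst (C / k) v 1) (is_derive_expM (- k) v).
  move=> /is_derive_eq; apply.
  by rewrite mul0r addr0 mulrA mulrN divfK // mulNr.
have up : u t + C / k * expR (- k * t) <= u s + C / k * expR (- k * s).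
  apply: (@derive_le0_nincr (fun t => u t + C / k * expR (- k * t)) _ T) Ts st => v Tv.
    exact: (is_deriveD (uE v Tv) (expE v)).
  by rewrite subr_le0 (le_trans (ler_norm _)) ?duC.
have dn : - u t + C / k * expR (- k * t) <= - u s + C / k * expR (- k * s).
  apply: (@derive_le0_nincr (fun t => - u t + C / k * expR (- k * t)) _ T) Ts st => v Tv.
    exact: (is_deriveD (is_deriveN (uE v Tv)) (expE v)).
  by rewrite subr_le0 (le_trans (ler_norm _)) // normrN duC.
by rewrite ler_norml; apply/andP; split; lra.
Qed.

Section LinearEquation.
Variables (g h : R -> R) (l K : R).
Hypothesis gE : forall t, 0 < t -> is_derive t 1 g (- l * g t + h t).
Hypothesis hK : decays K h.

Let u t := expR (l * t) * g t.

Let uE t : 0 < t -> is_derive t 1 u (expR (l * t) * h t).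
Proof.
move=> t0; apply: is_derive_eq (is_derive_mul (is_derive_expM l t) (gE t0)) _.
by rewrite mulrDr addrAC mulNr mulrN mulrA [_ * l]mulrC addNr add0r.
Qed.

Let gu t : g t = expR (- l * t) * u t.
Proof. by rewrite /u mulrA -expRD mulNr addNr expR0 mul1r. Qed.

Let u_bound k : k < K -> k != l -> exists C, exists2 T, 0 < T &
  forall s t, T <= s -> s <= t ->
    `|u t - u s| <= C / (k - l) * (expR (- (k - l) * s) - expR (- (k - l) * t)).
Proof.
move=> kK kl; have [C /near_pinfty_ex[T T0 hC]] := hK kK.
exists C, T => //; apply: derive_exp_bound; first by rewrite subr_eq0.
  by move=> t Tt; apply: uE; apply: lt_le_trans Tt.
move=> t Tt; rewrite normrM ger0_norm ?expR_ge0 //.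
have -> : - (k - l) * t = l * t + - k * t by lra.
by rewrite expRD mulrCA ler_wpM2l ?expR_ge0 ?hC.
Qed.

(** Variation of constants: [expR (l * t) * g t] has a derivative that grows at most
    like [expR ((l - k) * t)], hence so does this function. *)
Lemma linear_equation_fast : K <= l -> decays K g.
Proof.
move=> Kl k kK; have kl : k < l by exact: lt_le_trans Kl.
have [|C [T T0 uC]] := @u_bound k kK; first by rewrite lt_eqF.
exists (`|u T| + `|C / (k - l)|); near=> t.
have Tt : T <= t by near: t; exact: nbhs_pinfty_ge (num_real _).
have t0 : 0 <= t by apply: le_trans Tt; exact: ltW.
rewrite gu normrM ger0_norm ?expR_ge0 //.
have -> : - k * t = - l * t + (- (k - l) * t) by lra.
rewrite expRD mulrCA ler_wpM2l ?expR_ge0 //.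
rewrite -(subrK (u T) (u t)) addrC (le_trans (ler_normD _ _)) // mulrDl.
have exp_ge1 : 1 <= expR (- (k - l) * t).
  by rewrite -expR0 ler_expR mulr_ge0 // oppr_ge0 subr_le0 ltW.
rewrite lerD // ?ler_peMr //; apply: le_trans (uC _ _ (lexx T) Tt) _.
apply: le_trans (ler_norm _) _; rewrite normrM ler_wpM2l // distrC.
have Te : expR (- (k - l) * T) <= expR (- (k - l) * t).
  by rewrite ler_expR ler_wpM2l // oppr_ge0 subr_le0 ltW.
by rewrite ger0_norm ?subr_ge0 // gerBl expR_ge0.
Unshelve. all: by end_near. Qed.

Let u_cauchy k : l < k < K -> exists C, exists2 T, 0 < T &
  forall s t, T <= s -> s <= t -> `|u t - u s| <= C * expR (- (k - l) * s).
Proof.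
move=> /andP[lk kK]; have [|C [T T0 uC]] := @u_bound k kK; first by rewrite gt_eqF.
exists `|C / (k - l)|, T => // s t Ts st; apply: le_trans (uC s t Ts st) _.
apply: le_trans (ler_norm _) _; rewrite normrM ler_wpM2l //.
have se : expR (- (k - l) * t) <= expR (- (k - l) * s).
  by rewrite ler_expR ler_wnM2l // oppr_le0 subr_ge0 ltW.
by rewrite ger0_norm ?subr_ge0 // gerBl expR_ge0.
Qed.

(** Variation of constants: the derivative of [expR (l * t) * g t] is integrable, so
    that this function has a limit [b], approached at the rate of the tail of
    the integral. *)
Lemma linear_equation_slow : l < K ->
  exists b, decays K (fun t => g t - b * expR (- l * t)).
Proof.
move=> lK; pose k0 := (l + K) / 2.
have k0lK : l < k0 < K by rewrite /k0; apply/andP; split; lra.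
have [b ub] : exists b : R, u t @[t --> +oo] --> b.
  apply/cvg_ex; apply: (@cauchy_cvg _ (u t @[t --> +oo]) _).
  apply: (@cauchy_exP _ _ (u t @[t --> +oo]) _) => eps eps0.
  have [C [T T0 uC]] := u_cauchy k0lK.
  have : littleo_exp 0 (fun t => C * expR (- (k0 - l) * t)).
    apply: (@decays_littleo (k0 - l)); last by rewrite subr_gt0; case/andP: k0lK.
    by apply: decaysZ; exact: decays_exp.
  move=> /cvgrPdist_lt /(_ eps eps0) /near_pinfty_ex[S S0 CS].
  pose s := Num.max S T.
  exists (u s); apply: filterS (nbhs_pinfty_ge (num_real s)) => t st.
  have Ss : S <= s by rewrite le_max lexx.
  have Ts : T <= s by rewrite le_max lexx orbT.
  rewrite /ball /= distrC; apply: le_lt_trans (uC s t Ts st) _.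
  have := CS s Ss; rewrite sub0r normrN mul0r expR0 mulr1.
  exact: le_lt_trans (ler_norm _).
exists b => k kK.
(* the limit [b] does not depend on the rate, which only has to exceed [l] *)
pose k1 := Num.max k k0.
have k1lK : l < k1 < K.
  by case/andP: k0lK => lk0 k0K; rewrite /k1 lt_max lk0 orbT gt_max kK k0K.
have [C [T T0 uC]] := u_cauchy k1lK.
exists `|C|; near=> s.
have Ts : T <= s by near: s; exact: nbhs_pinfty_ge (num_real _).
have s0 : 0 <= s by apply: le_trans Ts; exact: ltW.
have bu : `|u s - b| <= C * expR (- (k1 - l) * s).
  apply/ler_addgt0Pr => eps eps0.
  move/cvgrPdist_le : ub => /(_ eps eps0)/near_pinfty_ex[S S0 uS].
  pose t := Num.max S s.
  have /uS ut : S <= t by rewrite le_max lexx.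
  have st : s <= t by rewrite le_max lexx orbT.
  rewrite -(subrKA (u t)) (le_trans (ler_normD _ _)) // lerD //.
    by rewrite distrC uC.
  by rewrite distrC.
rewrite gu [b * _]mulrC -mulrBr normrM ger0_norm ?expR_ge0 //.
apply: le_trans (ler_wpM2l (expR_ge0 _) bu) _.
rewrite mulrCA -expRD; apply: le_trans (ler_norm _) _.
rewrite normrM ler_wpM2l // ger0_norm ?expR_ge0 // ler_expR.
have : k * s <= k1 * s by rewrite ler_wpM2r // le_max lexx.
lra.
Unshelve. all: by end_near. Qed.
End LinearEquation.
End Decay.

(** * Vector-valued decay and linear systems *)

Section VectorDecay.
Context {R : realType} {n : nat}.
Implicit Types (x p : R -> 'rV[R]_n) (K : R).

Lemma decays_coord K x j : decays K (fun t => `|x t|) ->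
  decays K (fun t => x t 0 j).
Proof.
apply: (@decays_bound _ _ 1); apply: nearW => t.
by rewrite mul1r normr_id rV_norm_ge.
Qed.

Lemma decays_rV K x : (forall j, decays K (fun t => x t 0 j)) ->
  decays K (fun t => `|x t|).
Proof.
move=> xK; apply: (@decays_bound _ _ 1 _ (fun t => \sum_j `|x t 0 j|)).
  apply: nearW => t; rewrite mul1r normr_id ger0_norm ?sumr_ge0 //.
  apply: rV_norm_le => [|j]; first exact: sumr_ge0.
  by rewrite (bigD1 j) //= lerDl sumr_ge0.
apply: decays_sum => j _; apply: (@decays_bound _ _ 1) (xK j).
by apply: nearW => t; rewrite mul1r normr_id.
Qed.

Lemma decays_normD K x p : decays K (fun t => `|x t|) ->
  decays K (fun t => `|p t|) -> decays K (fun t => `|x t + p t|).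
Proof.
move=> xK pK; apply: decays_rV => j.
apply: eq_decays (decaysD (decays_coord j xK) (decays_coord j pK)).
by apply: nearW => t; rewrite mxE.
Qed.

Lemma decays_normN K x : decays K (fun t => `|x t|) ->
  decays K (fun t => `|- x t|).
Proof. by apply: eq_decays; apply: nearW => t; rewrite normrN. Qed.

Lemma eq_decays_norm K x p : (forall t, x t = p t) ->
  decays K (fun t => `|p t|) -> decays K (fun t => `|x t|).
Proof. by move=> xp; apply: eq_decays; apply: nearW => t; rewrite xp. Qed.

Lemma decays_norm_sum K (I : Type) (r : seq I) (P : pred I) (f : I -> R -> 'rV[R]_n) :
  (forall i, P i -> decays K (fun t => `|f i t|)) ->
  decays K (fun t => `|\sum_(i <- r | P i) f i t|).
Proof.
move=> fK; apply: decays_rV => j.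
apply: (@eq_decays _ _ _ (fun t => \sum_(i <- r | P i) f i t 0 j)).
  by apply: nearW => t; rewrite summxE.
by apply: decays_sum => i Pi; exact/decays_coord/fK.
Qed.

Lemma mulmx_bound m (A : 'M[R]_(n, m)) :
  exists2 C, 0 <= C & forall v : 'rV[R]_n, `|v *m A| <= C * `|v|.
Proof.
exists (\sum_i \sum_j `|A i j|) => [|v]; first by do 2?apply: sumr_ge0 => ? _.
apply: rV_norm_le => [|j]; first by rewrite mulr_ge0 //; do 2?apply: sumr_ge0 => ? _.
rewrite mxE mulr_suml; apply: le_trans (ler_norm_sum _ _ _) _; apply: ler_sum => i _.
rewrite normrM mulrC ler_pM ?rV_norm_ge // (bigD1 j) //= lerDl.
by apply: sumr_ge0.
Qed.

Lemma decays_mulmx m (A : 'M[R]_(n, m)) K x : decays K (fun t => `|x t|) ->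
  decays K (fun t => `|x t *m A|).
Proof.
have [C C0 AC] := mulmx_bound A.
by apply: (@decays_bound _ _ C); apply: nearW => t; rewrite !normr_id.
Qed.

Lemma is_derive_row x (dx : 'rV[R]_n) (t : R) : is_derive t 1 x dx ->
  forall j, is_derive t 1 (fun t => x t 0 j) (dx 0 j).
Proof.
move=> [dl dE] j; apply: DeriveDef; first by move/derivable_mxP: dl.
by rewrite -dE derive_mx // mxE.
Qed.

Lemma is_derive_mulmx m (A : 'M[R]_(n, m)) x (dx : 'rV[R]_n) (t : R) :
  (forall j, is_derive t 1 (fun t => x t 0 j) (dx 0 j)) ->
  forall i, is_derive t 1 (fun t => (x t *m A) 0 i) ((dx *m A) 0 i).
Proof.
move=> xE i.
have -> : (fun t => (x t *m A) 0 i) = \sum_j (fun t => x t 0 j * A j i).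
  by apply/funext => s; rewrite mxE fct_sumE.
rewrite mxE; apply: is_derive_sum => j.
apply: is_derive_eq (is_derive_mul (xE j) (is_derive_cst (A j i) t 1)) _.
by rewrite mulr0 add0r.
Qed.

Lemma sqr_norm_le (v : 'rV[R]_n) : `|v| ^+ 2 <= \sum_i v 0 i ^+ 2.
Proof.
have s0 : 0 <= \sum_i v 0 i ^+ 2 by apply: sumr_ge0 => i _; exact: sqr_ge0.
rewrite -[leRHS]sqr_sqrtr // lerXn2r ?nnegrE ?sqrtr_ge0 //.
apply: rV_norm_le => [|j]; first exact: sqrtr_ge0.
rewrite -sqrtr_sqr ler_sqrt // (bigD1 j) //= lerDl.
by apply: sumr_ge0 => i _; exact: sqr_ge0.
Qed.

Lemma is_derive_sqr_sum x (dx : 'rV[R]_n) (t : R) :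
  (forall j, is_derive t 1 (fun t => x t 0 j) (dx 0 j)) ->
  is_derive t 1 (fun t => \sum_i x t 0 i ^+ 2) (2 * \sum_i x t 0 i * dx 0 i).
Proof.
move=> xE.
have -> : (fun t => \sum_i x t 0 i ^+ 2) = \sum_i (fun t => x t 0 i * x t 0 i).
  by apply/funext => s; rewrite fct_sumE; apply: eq_bigr => i _; rewrite expr2.
rewrite mulr_sumr; apply: is_derive_sum => j.
apply: is_derive_eq (is_derive_mul (xE j) (xE j)) _.
by rewrite [dx 0 j * _]mulrC -mulr2n mulr_natl.
Qed.

(** The crude bound that turns [`|w'| <= C `|w|] into a linear differential inequality
    for the sum of squares. *)
Lemma sum_mul_le (v w : 'rV[R]_n) C : 0 <= C -> `|w| <= C * `|v| ->
  \sum_i v 0 i * w 0 i <= n%:R * C * \sum_i v 0 i ^+ 2.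
Proof.
move=> C0 wC; apply: le_trans (ler_norm _) _.
apply: le_trans (ler_norm_sum _ _ _) _.
apply: (@le_trans _ _ (n%:R * (C * `|v| ^+ 2))); last first.
  by rewrite -mulrA !ler_wpM2l // sqr_norm_le.
rewrite mulr_natl -[X in _ *+ X](card_ord n) -sumr_const; apply: ler_sum => i _.
rewrite normrM expr2 mulrCA ler_pM ?rV_norm_ge //.
exact: le_trans (rV_norm_ge _ _) wC.
Qed.
End VectorDecay.

(** A linear relation between the eigenvectors [v i] puts [w 0 i *: v i] in the
    intersection of one eigenspace with the sum of the others, which is
    zero. *)
Lemma distinct_eigenbasis (F : fieldType) (n : nat) (L : 'M[F]_n) (a : 'I_n -> F) :
  injective a -> (forall i, eigenvalue L (a i)) ->
  exists2 V : 'M[F]_n, V \in unitmx & forall i, row i V *m L = a i *: row i V.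
Proof.
move=> a_inj aL; have /(_ _)/cid2-/all_sig2[v vL v0] := fun i => eigenvalueP (aL i).
exists (\matrix_i v i) => [|i]; last by rewrite rowK.
rewrite -row_free_unit; apply: inj_row_free => w.
rewrite mulmx_sum_row; under eq_bigr do rewrite rowK; move=> wv0.
apply/rowP => i; rewrite mxE; apply/eqP.
suff : w 0 i *: v i == 0 by rewrite scaler_eq0 (negPf (v0 i)) orbF.
have /mxdirect_sumsP/(_ i isT) cap0 :=
  mxdirect_sum_eigenspace L (P := xpredT) (in2W a_inj).
rewrite -submx0 -cap0 sub_capmx; apply/andP; split.
  by apply: scalemx_sub; apply/eigenspaceP.
move: wv0; rewrite (bigD1 i) //= => /eqP; rewrite addr_eq0 => /eqP ->.
rewrite eqmx_opp; apply: summx_sub_sums => j _.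
by apply: scalemx_sub; apply/eigenspaceP.
Qed.

Section DiagonalSystem.
Context {R : realType} {n : nat}.
Variables (L V : 'M[R]_n) (lam : 'I_n -> R).
Hypothesis V_unit : V \in unitmx.
Hypothesis VL : forall i, row i V *m L = - lam i *: row i V.

(** The rows [row i V] are eigenvectors of [L], that is, [V^T] gives the
    coordinates in which the system [x' = x L^T] is diagonal; [dual_basis i]
    is the eigenvector of [L^T] with coordinates [delta_i]. *)
Definition dual_basis (i : 'I_n) : 'rV[R]_n := row i (invmx V^T).

Lemma VT_unit : V^T \in unitmx. Proof. by rewrite unitmx_tr. Qed.

Lemma coord_LT (x : 'rV[R]_n) i : (x *m L^T *m V^T) 0 i = - lam i * (x *m V^T) 0 i.
Proof.
rewrite -mulmxA -trmx_mul [LHS]mxE [in RHS]mxE mulr_sumr; apply: eq_bigr => j _.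
have VLij : (V *m L) i j = - lam i * V i j.
  by have /(congr1 (fun v : 'rV_n => v 0 j)) := VL i; rewrite -row_mul !mxE.
by rewrite [_^T j i]mxE VLij [V^T j i]mxE mulrCA.
Qed.

Lemma coord_expand (x : 'rV[R]_n) : x = \sum_i (x *m V^T) 0 i *: dual_basis i.
Proof.
by rewrite -mulmx_sum_row mulmxK // VT_unit.
Qed.

Lemma coord_dual i j : (dual_basis i *m V^T) 0 j = (i == j)%:R.
Proof. by rewrite -row_mul mulVmx ?VT_unit // !mxE eq_sym. Qed.

Lemma dual_LT i : dual_basis i *m L^T = - lam i *: dual_basis i.
Proof.
rewrite [LHS]coord_expand (bigD1 i) //= coord_LT coord_dual eqxx mulr1.
rewrite big1 ?addr0 // => j /negPf j_neq.
by rewrite coord_LT coord_dual eq_sym j_neq mulr0 scale0r.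
Qed.

(** The equation [r' = r L^T + p], coordinate by coordinate and for [t > 0]. *)
Definition solves (p r : R -> 'rV[R]_n) := forall t : R, 0 < t -> forall j,
  is_derive t 1 (fun t => r t 0 j) ((r t *m L^T + p t) 0 j).

Lemma solves_coord p r : solves p r -> forall t : R, 0 < t -> forall i,
  is_derive t 1 (fun t => (r t *m V^T) 0 i)
    (- lam i * (r t *m V^T) 0 i + (p t *m V^T) 0 i).
Proof.
move=> rp t t0 i; apply: is_derive_eq (is_derive_mulmx V^T (rp t t0) i) _.
by rewrite mulmxDl mxE coord_LT.
Qed.

Lemma linear_system_asymptotics p r K : solves p r -> decays K (fun t => `|p t|) ->
  exists b : 'I_n -> R, (forall i, K <= lam i -> b i = 0) /\
  decays K (fun t => `|r t - \sum_i (b i * expR (- lam i * t)) *: dual_basis i|).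
Proof.
move=> rp pK.
have bP i : exists b : R, (K <= lam i -> b = 0) /\
    decays K (fun t => (r t *m V^T) 0 i - b * expR (- lam i * t)).
  have piK : decays K (fun t => (p t *m V^T) 0 i).
    exact: (decays_coord _ (decays_mulmx _ pK)).
  have rE t (t0 : 0 < t) := solves_coord rp t0 i.
  have [Kl|lK] := leP K (lam i); last first.
    by have [b bK] := linear_equation_slow rE piK lK; exists b.
  exists 0; split=> //.
  apply: eq_decays (linear_equation_fast rE piK Kl).
  by apply: nearW => t; rewrite mul0r subr0.
have /(_ _)/cid-/all_sig[b bK] := bP.
exists b; split=> [i Kl|]; first by case: (bK i) => ->.
apply: (eq_decays_norm (p := fun t =>
  (\row_i ((r t *m V^T) 0 i - b i * expR (- lam i * t))) *m invmx V^T)).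
  move=> t; rewrite mulmx_sum_row {1}[r t]coord_expand -sumrB; apply: eq_bigr => i _.
  by rewrite -scalerBl [in RHS]mxE.
apply: decays_mulmx; apply: decays_rV => i.
apply: eq_decays (bK i).2; by apply: nearW => t; rewrite mxE.
Qed.

(** A term [b i * expR (- lam i * t)] does not decay at a rate larger than [lam i], so
    it cannot occur in a function that does. *)
Lemma linear_system_limit0 (r : R -> 'rV[R]_n) (b : 'I_n -> R) K K' i :
  lam i < K -> lam i < K' -> decays K' (fun t => `|r t|) ->
  decays K (fun t => `|r t - \sum_i (b i * expR (- lam i * t)) *: dual_basis i|) ->
  b i = 0.
Proof.
move=> lK lK' rK' rK; pose k := Num.min K K'.
have lk : lam i < k by rewrite lt_min lK.
have bk : decays k (fun t => b i * expR (- lam i * t)).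
  have h1 := decays_coord i (decays_mulmx V^T rK').
  have h2 := decays_coord i (decays_mulmx V^T rK).
  have [kK kK'] : k <= K /\ k <= K' by rewrite !ge_min !lexx orbT.
  apply: eq_decays (decaysB (decays_le kK' h1) (decays_le kK h2)).
  apply: nearW => t; rewrite mulmxBl [X in _ = _ - X]mxE opprD addNKr.
  rewrite [X in _ = - X]mxE opprK mulmx_suml summxE (bigD1 i) //= big1 => [|j /negPf ji].
    by rewrite addr0 -scalemxAl mxE coord_dual eqxx mulr1.
  by rewrite -scalemxAl mxE coord_dual ji mulr0.
have bl := decays_littleo bk lk.
have E : (fun t => b i * expR (- lam i * t) * expR (lam i * t)) = fun=> b i.
  by apply/funext => t; rewrite -mulrA -expRD mulNr addNr expR0 mulr1.
rewrite /littleo_exp E in bl.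
exact: (cvg_unique (@norm_hausdorff _ _) (cvg_cst (b i)) bl).
Qed.

(** The sum of squares [u] of the eigencoordinates is a Lyapunov function: near the
    origin the nonlinear part is as small as desired compared with the linear
    part, so that [u' <= - 2 k u] for any given [k < l]. *)
Lemma apriori_decay N (x : R -> 'rV[R]_n) (l C : R) : (forall i, l <= lam i) -> 0 <= C ->
  (forall v : 'rV[R]_n, `|v| <= 1 -> `|N v| <= C * `|v| ^+ 2) ->
  solves (fun t => N (x t)) x ->
  x t @[t --> +oo] --> (0 : 'rV[R]_n) -> decays l (fun t => `|x t|).
Proof.
move=> l_lam C0 NC xN x0 k kl.
have [CV CV0 VC] := mulmx_bound V^T.
have [CW CW0 WC] := mulmx_bound (invmx V^T).
pose M := n%:R * (CV * (C * CW)); have M0 : 0 <= M by rewrite !mulr_ge0.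
(* a ball so small that the nonlinear part costs at most [l - k] *)
pose eta := Num.min 1 ((l - k) / (M + 1)).
have M1 : 0 < M + 1 by rewrite ltr_wpDl.
have eta0 : 0 < eta by rewrite lt_min ltr01 divr_gt0 // subr_gt0.
have /near_pinfty_ex[T T0 xT] : \forall t \near +oo, `|x t| <= eta.
  move/cvgrPdist_le : x0 => /(_ eta eta0); apply: filterS => t.
  by rewrite sub0r normrN.
pose y t := x t *m V^T; pose u t := \sum_i y t 0 i ^+ 2.
have u0 t : 0 <= u t by apply: sumr_ge0 => i _; exact: sqr_ge0.
pose q t := N (x t) *m V^T.
have qle t : T <= t -> `|q t| <= CV * (C * CW) * eta * `|y t|.
  move=> Tt; apply: le_trans (VC _) _; rewrite -!mulrA ler_wpM2l //.
  apply: le_trans (NC _ _) _; first by rewrite (le_trans (xT t Tt)) // ge_min lexx.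
  rewrite ler_wpM2l // expr2 mulrCA ler_pM // ?xT //.
  by have := WC (y t); rewrite mulmxK // VT_unit.
pose dy t : 'rV[R]_n := \row_i (- lam i * y t 0 i + q t 0 i).
have yE t : T <= t -> forall i, is_derive t 1 (fun t => y t 0 i) (dy t 0 i).
  move=> Tt i; rewrite mxE; exact: (solves_coord xN (lt_le_trans T0 Tt)). 
have uE t : T <= t -> is_derive t 1 u (2 * \sum_i y t 0 i * dy t 0 i).
  by move=> Tt; exact: (is_derive_sqr_sum (yE t Tt)).
have du_le t : T <= t -> 2 * \sum_i y t 0 i * dy t 0 i <= - (2 * k) * u t.
  move=> Tt; rewrite mulNr -mulrN -mulrA ler_pM2l //.
  have -> : \sum_i y t 0 i * dy t 0 i =
      - (\sum_i lam i * y t 0 i ^+ 2) + \sum_i y t 0 i * q t 0 i.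
    rewrite -sumrN -big_split; apply: eq_bigr => i _ /=.
    by rewrite [dy t 0 i]mxE; ring.
  have h1 : l * u t <= \sum_i lam i * y t 0 i ^+ 2.
    by rewrite mulr_sumr; apply: ler_sum => i _; rewrite ler_wpM2r // sqr_ge0.
  have h2 : \sum_i y t 0 i * q t 0 i <= n%:R * (CV * (C * CW) * eta) * u t.
    by apply: sum_mul_le; rewrite ?qle // !mulr_ge0 // ltW.
  have h3 : n%:R * (CV * (C * CW) * eta) <= l - k.
    rewrite mulrA -/M; apply: (@le_trans _ _ ((M + 1) * eta)).
      by rewrite ler_wpM2r ?(ltW eta0) // lerDl.
    by rewrite mulrC -ler_pdivlMr // ge_min lexx orbT.
  have := ler_wpM2r (u0 t) h3; lra.
have wE t : T <= t -> is_derive t 1 (fun t => expR (2 * k * t) * u t)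
   (expR (2 * k * t) * (2 * \sum_i y t 0 i * dy t 0 i) + 2 * k * expR (2 * k * t) * u t).
  by move=> Tt; exact: is_derive_mul (is_derive_expM _ _) (uE t Tt).
have w_nincr := derive_le0_nincr wE.
have {}w_nincr t : T <= t -> expR (2 * k * t) * u t <= expR (2 * k * T) * u T.
  move=> Tt; apply: (w_nincr _ T t) => // s Ts.
  have := ler_wpM2l (expR_ge0 (2 * k * s)) (du_le s Ts); lra.
pose B := expR (2 * k * T) * u T.
have B0 : 0 <= B by rewrite mulr_ge0 ?expR_ge0.
suff : bigO_exp k (fun t => `|y t|).
  move=> [D yD]; exists (CW * D); near=> t.
  rewrite normr_id -{1}[x t](mulmxK VT_unit); apply: le_trans (WC _) _.
  by rewrite -mulrA ler_wpM2l // -[`|x t *m V^T|]normr_id; near: t.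
exists (Num.sqrt B); near=> t; rewrite normr_id.
have Tt : T <= t by near: t; exact: nbhs_pinfty_ge (num_real _).
rewrite -(@ler_pXn2r _ 2) ?nnegrE ?mulr_ge0 ?sqrtr_ge0 ?expR_ge0 //.
apply: le_trans (sqr_norm_le _) _; rewrite exprMn sqr_sqrtr // expr2 -expRD.
rewrite -[leLHS](mulKf (lt0r_neq0 (expR_gt0 (2 * k * t)))).
have -> : - k * t + - k * t = - (2 * k * t) by lra.
by rewrite expRN mulrC ler_wpM2r ?invr_ge0 ?expR_ge0 // w_nincr.
Unshelve. all: by end_near. Qed.
End DiagonalSystem.

(** * Degrees and weights of multi-indices *)

Section Indices.
Context {n : nat}.
Implicit Types chi : multi_index n.

Lemma degree_eq0 chi : degree chi = 0%N -> chi = [ffun=> 0%N].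
Proof.
move=> /eqP; rewrite sum_nat_eq0 => /forallP chi0.
by apply/ffunP => i; rewrite ffunE; apply/eqP/chi0.
Qed.

Lemma degree_gt0P chi : (0 < degree chi)%N -> exists i, (0 < chi i)%N.
Proof.
apply: contraPP => /forallNP chi0; rewrite [degree chi]big1 // => i _.
by apply/eqP; rewrite -leqn0 leqNgt; apply/negP/chi0.
Qed.

Lemma degree_unit (i : 'I_n) : degree (unit_index i) = 1%N.
Proof.
rewrite [degree _](bigD1 i) //= ffunE eqxx big1 // => j /negPf ji.
by rewrite ffunE ji.
Qed.

Lemma degree_eq1 chi : degree chi = 1%N -> exists i, chi = unit_index i.
Proof.
move=> chi1; have [|i chi_i] := @degree_gt0P chi; first by rewrite chi1.
exists i; apply/ffunP => j; rewrite ffunE.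
move: chi1; rewrite [degree _](bigD1 i) //= => chi1.
have eq1 a b : (0 < a)%N -> (a + b = 1)%N -> a = 1%N /\ b = 0%N by lia.
have [chi_i1 /eqP] := eq1 _ _ chi_i chi1.
rewrite sum_nat_eq0 => /forallP chi0.
case: eqVneq => [->//|ji]; apply/eqP; exact: (implyP (chi0 j) ji).
Qed.

Lemma sum_indices_le (V : nmodType) (m M : nat) (f : multi_index n -> V) : (m <= M)%N ->
  \sum_(chi <- indices n M | (degree chi <= m)%N) f chi =
  \sum_(chi <- indices n m) f chi.
Proof.
move=> mM; rewrite -big_filter; apply: perm_big; apply: uniq_perm.
- exact/filter_uniq/indices_uniq.
- exact: indices_uniq.
move=> chi; rewrite mem_filter !mem_indices.
by case: leqP => // chi_m; rewrite (leq_trans chi_m).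
Qed.

Lemma sum_indices1 (V : nmodType) (m : nat) (f : multi_index n -> V) : (0 < m)%N ->
  \sum_(chi <- indices n m | degree chi == 1%N) f chi = \sum_(i < n) f (unit_index i).
Proof.
move=> m0; rewrite -big_filter.
rewrite (perm_big [seq unit_index i | i : 'I_n]) ?big_map ?big_enum //=.
apply: uniq_perm; first exact/filter_uniq/indices_uniq.
  rewrite map_inj_uniq ?enum_uniq // => i j /ffunP/(_ i).
  by rewrite !ffunE eqxx; case: eqVneq.
move=> chi; rewrite mem_filter mem_indices; apply/andP/mapP.
  move=> [/eqP/degree_eq1[i ->] _]; exists i => //; exact: mem_enum.
by move=> [i _ ->]; rewrite degree_unit.
Qed.
End Indices.

Section Weight.
Context {R : realType} {n : nat}.
Variables (lam : 'I_n -> R) (l : R).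
Hypothesis l_gt0 : 0 < l.
Hypothesis l_lam : forall i, l <= lam i.
Implicit Types chi : multi_index n.

Lemma degree_weight chi : (degree chi)%:R * l <= weight lam chi.
Proof.
rewrite natr_sum mulr_suml; apply: ler_sum => i _.
by rewrite ler_wpM2l.
Qed.

(** Besides one copy of [j], a multi-index of degree at least 2 has another index
    (possibly [j] again), of weight at least [l]. *)
Lemma weight_ge2 chi j : (0 < chi j)%N -> (1 < degree chi)%N ->
  lam j + l <= weight lam chi.
Proof.
move=> chij chi2; rewrite /weight (bigD1 j) //=.
move: chi2; rewrite [degree _](bigD1 j) //= => chi2.
have lam0 i : 0 <= lam i by apply: le_trans (l_lam i); exact: ltW.
have [chij1|chij2] := leqP (chi j) 1.
  have /eqP chij1' : chi j == 1%N by rewrite eqn_leq chij1.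
  rewrite chij1' mul1r lerD2l; move: chi2.
  rewrite chij1' add1n ltnS => chi2.
  have [i /andP[ij chii]] : exists i, (i != j) && (0 < chi i)%N.
    move: chi2; apply: contraPP => /forallNP chi0; rewrite big1 // => i ij.
    by apply/eqP; rewrite -leqn0 leqNgt; apply/negP => chii; apply: (chi0 i); rewrite ij.
  rewrite (bigD1 i) //=; apply: (@le_trans _ _ ((chi i)%:R * lam i)).
    by apply: le_trans (l_lam i) _; rewrite ler_peMl // ler1n.
  by rewrite lerDl; apply: sumr_ge0 => k _; rewrite mulr_ge0.
apply: (@le_trans _ _ (2 * lam j)).
  by rewrite mulr_natl mulr2n lerD2l.
apply: (@le_trans _ _ ((chi j)%:R * lam j)); first by rewrite ler_wpM2r // ler_nat.
by rewrite lerDl; apply: sumr_ge0 => k _; rewrite mulr_ge0.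
Qed.

Lemma prod_expR chi t :
  \prod_j expR (- lam j * t) ^+ chi j = expR (- weight lam chi * t).
Proof.
rewrite /weight -sumrN mulr_suml expR_sum; apply: eq_bigr => j _.
by rewrite -expRM_natl; congr expR; ring.
Qed.

Lemma weight_unit (i : 'I_n) : weight lam (unit_index i) = lam i.
Proof.
rewrite /weight (bigD1 i) //= ffunE eqxx mul1r big1 ?addr0 // => j /negPf ji.
by rewrite ffunE ji mul0r.
Qed.
End Weight.

(** * The truncated expansion as an approximate solution *)

Lemma is_derive_seq_sum (R : realType) (I : Type) (r : seq I) (f : I -> R -> R)
    (df : I -> R) (t : R) :
  (forall i, is_derive t 1 (f i) (df i)) ->
  is_derive t 1 (fun t => \sum_(i <- r) f i t) (\sum_(i <- r) df i).
Proof.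
move=> fE; elim: r => [|i r IHr].
  rewrite big_nil (_ : (fun _ => _) = cst 0); first exact: is_derive_cst.
  by apply/funext => s; rewrite big_nil.
rewrite big_cons (_ : (fun _ => _) = f i + (fun t => \sum_(j <- r) f j t)).
  exact: is_deriveD.
by apply/funext => s; rewrite big_cons.
Qed.

Lemma decays_near1 (R : realType) (n : nat) (x : R -> 'rV[R]_n) (K : R) :
  decays K (fun t => `|x t|) -> 0 < K -> \forall t \near +oo, `|x t| <= 1.
Proof.
move=> xK K0; have := decays_littleo xK K0.
move=> /cvgrPdist_le /(_ 1 ltr01); apply: filterS => t.
by rewrite sub0r normrN mul0r expR0 mulr1 normr_id.
Qed.

(** The derivative of [N] vanishes at the origin, so it is at most linear in the
    distance to the origin. *)
Lemma quadratic_lipschitz (R : realType) (n : nat) (N : 'rV[R]_n -> 'rV[R]_n) :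
  smooth N -> 'J N 0 = 0 -> exists2 C, 0 <= C &
  forall x y, `|x| <= 1 -> `|y| <= 1 ->
    `|N x - N y| <= C * (`|x| + `|y|) * `|x - y|.
Proof.
move=> sN JN0.
have dN i : exists2 B, 0 <= B & forall p, `|p| <= 3 ->
    `|'D_(delta_mx 0 i) N p| <= B * `|p|.
  have sdN := smooth_derive i sN.
  have /(_ _)/cid2-/all_sig2[B B0 dB] := fun j =>
    bounded_on_ball 3 (smooth_continuous (smooth_derive j sdN)).
  exists (n%:R * \sum_j B j) => [|p p3]; first by rewrite mulr_ge0 // sumr_ge0.
  have := @lipschitz_bound _ _ _ 3 (\sum_j B j) sdN _ _ p 0.
  rewrite derive_jacobian0 // !subr0 normr0 add0r; apply => //.
    exact: sumr_ge0.
  move=> j v /(dB j) h; apply: le_trans h _.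
  by rewrite (bigD1 j) //= lerDl sumr_ge0.
have /(_ _)/cid2-/all_sig2[B B0 dB] := dN.
pose S := \sum_j B j; have S0 : 0 <= S by exact: sumr_ge0.
exists (n%:R * S * 2) => [|x y x1 y1]; first by rewrite !mulr_ge0.
have xy : `|x - y| <= `|x| + `|y| by exact: ler_normB.
have rho3 : `|y| + `|x - y| <= 3 by lra.
have h : `|N x - N y| <= n%:R * (S * (`|y| + `|x - y|)) * `|x - y|.
  apply: (@lipschitz_bound _ _ _ (`|y| + `|x - y|)) => //.
    by rewrite mulr_ge0 // addr_ge0.
  move=> i p p_le; apply: le_trans (dB i p (le_trans p_le rho3)) _.
  by apply: ler_pM => //; rewrite /S (bigD1 i) //= lerDl sumr_ge0.
apply: le_trans h _; rewrite ler_wpM2r // -!mulrA !ler_wpM2l //.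
by have := normr_ge0 x; lra.
Qed.

Section FormalExpansion.
Context {R : realType} {n : nat}.
Variables (L : 'M[R]_n) (N : 'rV[R]_n -> 'rV[R]_n) (lam : 'I_n -> R) (l : R).
Hypothesis N_smooth : smooth N.
Hypothesis N0 : N 0 = 0.
Hypothesis JN0 : 'J N 0 = 0.
Hypothesis eigenL : forall a : R, eigenvalue L a <-> exists i, a = - lam i.
Hypothesis l_gt0 : 0 < l.
Hypothesis l_lam : forall i, l <= lam i.
Hypothesis lam_incr : forall i j : 'I_n, (i < j)%N -> - lam j < - lam i.
Hypothesis nonresonant : forall (i : 'I_n) (chi : multi_index n),
  lam i <> \sum_(j < n | (j < i)%N) (chi j)%:R * lam j.
Implicit Types chi : multi_index n.

Definition taylor_coef (s : seq 'I_n) : 'rV[R]_n :=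
  ((size s)`!%:R)^-1 *: partials s N 0.

Definition resolvent chi : 'M[R]_n := invmx ((- weight lam chi)%:M - L^T).

(** The hypothesis excludes the combinations of the [lam j] with [j < i]; if another
    index occurs in [chi], the weight exceeds [lam i]. *)
Lemma weight_nonresonant chi i : (1 < degree chi)%N -> weight lam chi <> lam i.
Proof.
move=> chi2; have [chi0|/existsNP[j /not_implyP[ij /eqP chij]]] :=
    pselect (forall j : 'I_n, (i <= j)%N -> chi j = 0%N).
  move=> wE; apply: (nonresonant (i := i) (chi := chi)); rewrite -wE /weight.
  rewrite (bigID (fun j : 'I_n => (j < i)%N)) /= [X in _ + X]big1 ?addr0 // => j.
  by rewrite -leqNgt => /chi0 ->; rewrite mul0r.
have lam_ij : lam i <= lam j.
  move: ij; rewrite leq_eqVlt => /predU1P[/val_inj <-//|/lam_incr].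
  by rewrite ltrN2 => /ltW.
apply/eqP; rewrite gt_eqF //.
apply: lt_le_trans (weight_ge2 l_gt0 l_lam (j := j) _ chi2); last by rewrite lt0n.
by rewrite ltr_pwDr.
Qed.

Lemma resolvent_unit chi : (1 < degree chi)%N ->
  (- weight lam chi)%:M - L^T \in unitmx.
Proof.
move=> chi2; rewrite -unitmx_tr linearB /= tr_scalar_mx trmxK.
rewrite -row_free_unit -kermx_eq0; apply/negPn/negP => ker_neq0.
have : eigenvalue L (- weight lam chi).
  have unitN (A : 'M[R]_n) : (- A \in unitmx) = (A \in unitmx).
    by rewrite -scaleN1r unitmxZ // unitrN1.
  move: ker_neq0; rewrite /eigenvalue /eigenspace !kermx_eq0 !row_free_unit.
  by rewrite -opprB unitN.
by move=> /eigenL[i /oppr_inj] /(weight_nonresonant chi2).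
Qed.

(** The Taylor terms of degree 0 and 1 of [N] vanish, by [N0] and [JN0]. *)
Lemma taylor_substitute m (x : 'rV[R]_n) j : (taylor N m.+1 x) 0 j =
  \sum_(2 <= k < m.+1) \sum_(s : k.-tuple 'I_n)
    taylor_coef s 0 j * \prod_(i <- s) x 0 i.
Proof.
have term0 : taylor_term N x 0 = 0 by rewrite taylor_term0 N0.
have term1 : taylor_term N x 1 = 0.
  rewrite -[LHS]scale1r -[1]/(1%:R) taylor_termS big1 // => i _.
  by rewrite taylor_term0 derive_jacobian0 // scaler0.
have -> : taylor N m.+1 x = \sum_(2 <= k < m.+1) taylor_term N x k.
  rewrite /taylor -(big_mkord xpredT (taylor_term N x)).
  case: m => [|m]; first by rewrite big_nat1 term0 big_geq.
  by rewrite big_ltn // term0 add0r big_ltn // term1 add0r.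
rewrite summxE; apply: eq_bigr => k _; rewrite /taylor_term mxE summxE mulr_sumr.
apply: eq_bigr => s _; rewrite /taylor_coef size_tuple !mxE.
by rewrite -mulrA [X in _ = _ * X]mulrC.
Qed.

Variable c : multi_index n -> ('I_n -> 'rV[R]_n) -> 'rV[R]_n.
Hypothesis c0 : forall D, c [ffun=> 0%N] D = 0.
Hypothesis cU : forall i D, c (unit_index i) D = D i.
Hypothesis c_triangular : forall (i : 'I_n) chi,
  (forall j : 'I_n, (i < j)%N -> chi j = 0%N) ->
  forall D D' : 'I_n -> 'rV[R]_n,
    (forall j : 'I_n, (j <= i)%N -> D j = D' j) -> c chi D = c chi D'.
Hypothesis c_formal : forall D m, exists M h,
  [/\ (m <= M)%N,
      forall chi, (degree chi <= 1)%N -> h chi = 0,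
      forall chi, (1 < degree chi <= m)%N -> c chi D = h chi *m resolvent chi
    & forall (z : 'I_n -> R) j,
      \sum_(2 <= k < m.+1) \sum_(s : k.-tuple 'I_n) taylor_coef s 0 j *
        \prod_(i <- s)
          \sum_(chi <- indices n m) c chi D 0 i * \prod_l z l ^+ chi l =
      \sum_(chi <- indices n M) (h chi : 'rV[R]_n) 0 j * \prod_l z l ^+ chi l].

(** The truncated series at [z_i = expR (- lam i * t)]. *)
Definition expansion D m t : 'rV[R]_n :=
  \sum_(chi <- indices n m) expR (- weight lam chi * t) *: c chi D.

Lemma decays_term K chi (v : 'rV[R]_n) : K <= weight lam chi \/ v = 0 ->
  decays K (fun t => `|expR (- weight lam chi * t) *: v|).
Proof.
move=> [Kw|->]; last first.
  by apply: eq_decays (@decays0 _ K); apply: nearW => t; rewrite scaler0 normr0.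
apply: (@decays_bound _ _ `|v|) (decays_exp Kw); apply: nearW => t.
by rewrite normr_id normrZ mulrC.
Qed.

Lemma expansion_decays D m : decays l (fun t => `|expansion D m t|).
Proof.
apply: decays_norm_sum => chi _; apply: decays_term.
have [/degree_eq0 ->|chi_neq0] := eqVneq (degree chi) 0%N; first by right.
left; apply: le_trans (degree_weight l_lam chi).
by rewrite ler_peMl ?(ltW l_gt0) // ler1n lt0n.
Qed.

Lemma expansion_step D m :
  decays (m.+1%:R * l) (fun t => `|expansion D m.+1 t - expansion D m t|).
Proof.
apply: (eq_decays_norm (p := fun t =>
  \sum_(chi <- indices n m.+1 | ~~ (degree chi <= m)%N)
     expR (- weight lam chi * t) *: c chi D)).
  move=> t; rewrite /expansion (bigID (fun chi => (degree chi <= m)%N)) /=.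
  by rewrite sum_indices_le // addrAC subrr add0r.
apply: decays_norm_sum => chi; rewrite -ltnNge => m_chi; apply: decays_term; left.
by apply: le_trans (degree_weight l_lam chi); rewrite ler_wpM2r ?(ltW l_gt0) // ler_nat.
Qed.

(** Two families [D] and [D'] that agree at the indices [i] with [lam i < K] can only
    give different coefficients at a [chi] that involves some [lam j >= K]. *)
Lemma coef_low D D' K chi : (forall i, lam i < K -> D i = D' i) ->
  (1 < degree chi)%N -> K + l <= weight lam chi \/ c chi D' - c chi D = 0.
Proof.
move=> eqD chi2.
have [[j [chij Kj]]|lowchi] := pselect (exists j, (0 < chi j)%N /\ K <= lam j).
  left; apply: le_trans (weight_ge2 l_gt0 l_lam chij chi2).
  by rewrite lerD2r.
right; have [|i0 chi0] := @degree_gt0P _ chi; first exact: ltnW.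
have [i chii imax] :=
  @arg_maxnP _ i0 (fun i => 0 < chi i)%N (fun j : 'I_n => nat_of_ord j) chi0.
have lami : lam i < K.
  by rewrite ltNge; apply/negP => Ki; apply: lowchi; exists i.
rewrite (@c_triangular i chi _ D D') ?subrr // => j.
  move=> ij; apply/eqP; rewrite -leqn0 leqNgt; apply/negP => chij.
  by have := imax j chij; rewrite /geq /= leqNgt ij.
rewrite leq_eqVlt => /predU1P[/val_inj ->|ji]; first exact: eqD.
by apply: eqD; apply: lt_trans lami; rewrite -ltrN2 lam_incr.
Qed.

Lemma expansion_shift D D' K m : (0 < m)%N -> (forall i, lam i < K -> D i = D' i) ->
  decays (K + l) (fun t => `|expansion D' m t - expansion D m t -
    \sum_i expR (- lam i * t) *: (D' i - D i)|).
Proof.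
move=> m0 eqD; apply: (eq_decays_norm (p := fun t =>
  \sum_(chi <- indices n m | degree chi != 1%N)
     expR (- weight lam chi * t) *: (c chi D' - c chi D))).
  move=> t; rewrite /expansion -sumrB.
  under eq_bigr do rewrite -scalerBr.
  rewrite (bigID (fun chi => degree chi == 1%N)) /= sum_indices1 // addrAC.
  rewrite [X in X - _](eq_bigr (fun i => expR (- lam i * t) *: (D' i - D i))).
    by rewrite subrr add0r.
  by move=> i _; rewrite weight_unit !cU.
apply: decays_norm_sum => chi chi_neq1; apply: decays_term.
have [chi0|chi_gt0] := posnP (degree chi).
  by right; rewrite (degree_eq0 chi0) !c0 subrr.
by apply: coef_low => //; rewrite ltn_neqAle eq_sym chi_neq1.
Qed.

(** In degree at most [m] the terms of the linear part and of the Taylor polynomial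
    of [N] cancel, by the choice of the coefficients; the terms of higher
    degree have weight at least [m.+1%:R * l], and so has the Taylor
    remainder. *)
Lemma expansion_residual D m : (forall i, D i *m L^T = - lam i *: D i) ->
  exists2 rho, decays (m.+1%:R * l) (fun t => `|rho t|) &
    solves L (fun t => N (expansion D m t) + rho t) (expansion D m).
Proof.
move=> DL; have [M [h [mM h1 hG hE]]] := c_formal D m.
have hc chi : (degree chi <= m)%N ->
    - weight lam chi *: c chi D - c chi D *m L^T = h chi.
  move=> chi_m; rewrite -mul_mx_scalar -mulmxBr.
  have [chi_le1|chi_gt1] := leqP (degree chi) 1; last first.
    by rewrite hG ?chi_gt1 // mulmxKV // resolvent_unit.
  rewrite h1 // mulmxBr mul_mx_scalar.
  move: chi_le1; rewrite leq_eqVlt ltnS leqn0 => /predU1P[/degree_eq1[i ->]|].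
    by rewrite cU weight_unit DL subrr.
  by move=> /eqP/degree_eq0 ->; rewrite c0 scaler0 mul0mx subrr.
pose dZ t : 'rV[R]_n := \sum_(chi <- indices n m)
  (- weight lam chi * expR (- weight lam chi * t)) *: c chi D.
have dZE (t : R) j : is_derive t 1 (fun t => expansion D m t 0 j) (dZ t 0 j).
  have -> : (fun t => expansion D m t 0 j) = (fun t =>
      \sum_(chi <- indices n m) expR (- weight lam chi * t) * c chi D 0 j).
    by apply/funext => s; rewrite summxE; apply: eq_bigr => chi _; rewrite mxE.
  rewrite summxE; apply: is_derive_seq_sum => chi.
  apply: is_derive_eq (is_derive_mul (is_derive_expM _ t) (is_derive_cst _ t 1)) _.
  by rewrite mulr0 add0r mxE.
(* the defect, made of the terms of high degree and of the Taylor remainder *)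
pose rho t := dZ t - expansion D m t *m L^T - N (expansion D m t).
exists rho; last first.
  move=> t _ j; apply: is_derive_eq (dZE t j) _; congr (_ 0 j).
  by rewrite addrA /rho addrACA subrr addr0 addrC subrK.
apply: (eq_decays_norm (p := fun t =>
  - (\sum_(chi <- indices n M | ~~ (degree chi <= m)%N)
     expR (- weight lam chi * t) *: h chi) -
  (N (expansion D m t) - taylor N m.+1 (expansion D m t)))).
  move=> t; rewrite opprB addrA /rho; congr (_ - _).
  have -> : taylor N m.+1 (expansion D m t) =
      \sum_(chi <- indices n M) expR (- weight lam chi * t) *: h chi.
    apply/rowP => j; rewrite taylor_substitute summxE.
    have := hE (fun i => expR (- lam i * t)) j.
    have evalE (g : multi_index n -> 'rV[R]_n) k i :
        \sum_(chi <- indices n k) g chi 0 i * \prod_l0 expR (- lam l0 * t) ^+ chi l0 =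
        (\sum_(chi <- indices n k) expR (- weight lam chi * t) *: g chi) 0 i.
      rewrite summxE; apply: eq_bigr => chi _.
      by rewrite prod_expR mulrC mxE.
    rewrite evalE summxE => <-; apply: eq_bigr => k _; apply: eq_bigr => s _.
    by congr (_ * _); apply: eq_bigr => i _; rewrite evalE.
  rewrite [X in _ = _ + X](bigID (fun chi => (degree chi <= m)%N)) /=.
  rewrite sum_indices_le // [RHS]addrC addrK /dZ /expansion mulmx_suml -sumrB.
  apply: eq_big_seq => chi; rewrite mem_indices => chi_m.
  by rewrite -hc // scalerBr scalerA mulrC scalemxAl.
apply: decays_normD.
  apply: decays_normN; apply: decays_norm_sum => chi; rewrite -ltnNge => m_chi.
  apply: decays_term; left; apply: le_trans (degree_weight l_lam chi).
  by rewrite ler_wpM2r ?(ltW l_gt0) // ler_nat.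
apply: decays_normN; have [C C_ge0 NC] := taylor_remainder m.+1 N_smooth.
apply: (@decays_bound _ _ C) (decaysX (m := m.+1) (expansion_decays D m)).
apply: filterS (decays_near1 (expansion_decays D m) l_gt0) => t Z1.
by rewrite normr_id (ger0_norm (exprn_ge0 _ (normr_ge0 _))) NC.
Qed.
Variable V : 'M[R]_n.
Hypothesis V_unit : V \in unitmx.
Hypothesis VL : forall i, row i V *m L = - lam i *: row i V.

Definition modes (a : 'I_n -> R) (i : 'I_n) : 'rV[R]_n := a i *: dual_basis V i.

Lemma modes_LT a i : modes a i *m L^T = - lam i *: modes a i.
Proof.
by rewrite -scalemxAl (dual_LT V_unit VL) !scalerA mulrC.
Qed.

(** One step of the bootstrap.  The error [x - Z] solves a linear system whose
    forcing term gains the rate [l], because [N] is quadratic at 0.  What the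
    error does not gain is a sum of terms [b i * expR (- lam i * t)], absorbed
    by changing [a] into [a + b]. *)
Lemma expansion_improve (x : R -> 'rV[R]_n) a m :
  solves L (fun t => N (x t)) x -> decays l (fun t => `|x t|) ->
  decays (m.+1%:R * l) (fun t => `|x t - expansion (modes a) m.+1 t|) ->
  exists b : 'I_n -> R, (forall i, lam i < m.+1%:R * l -> b i = 0) /\
    decays (m.+2%:R * l)
      (fun t => `|x t - expansion (modes (fun i => a i + b i)) m.+1 t|).
Proof.
move=> xN xl; set Z := expansion (modes a) m.+1 => rK.
have [rho rhoK ZN] := expansion_residual m.+1 (modes_LT a).
rewrite -/Z in ZN.
pose p t := N (x t) - (N (Z t) + rho t).
have pr : solves L p (fun t => x t - Z t).
  move=> t t0 j; have -> : (fun t => (x t - Z t) 0 j) =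
      (fun t => x t 0 j) - (fun t => Z t 0 j).
    by apply/funext => s; rewrite !mxE.
  apply: is_derive_eq (is_deriveB (xN t t0 j) (ZN t t0 j)) _.
  by rewrite /p mulmxBl !mxE; ring.
have Kl : m.+2%:R * l = l + m.+1%:R * l by rewrite -[m.+2%:R]natr1; ring.
have pK : decays (m.+2%:R * l) (fun t => `|p t|).
  apply: (eq_decays_norm (p := fun t => (N (x t) - N (Z t)) - rho t)).
    by move=> t; rewrite /p opprD addrA.
  apply: decays_normD; last exact: decays_normN.
  have [C C0 NC] := quadratic_lipschitz N_smooth JN0.
  have Zl : decays l (fun t => `|Z t|) := expansion_decays (modes a) m.+1.
  rewrite Kl; apply: (@decays_bound _ _ C) (decaysM (decaysD xl Zl) rK).
  near=> t; have x1 : `|x t| <= 1 by near: t; exact: decays_near1 xl l_gt0.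
  have Z1 : `|Z t| <= 1 by near: t; exact: decays_near1 Zl l_gt0.
  rewrite normr_id (ger0_norm (mulr_ge0 _ _)) ?addr_ge0 // mulrA.
  exact: NC.
have [b [_ bK]] := linear_system_asymptotics V_unit VL pr pK.
have b0 i : lam i < m.+1%:R * l -> b i = 0.
  move=> lami; apply: linear_system_limit0 rK bK => //.
  by apply: lt_le_trans lami _; rewrite Kl lerDr ltW.
exists b; split=> //.
set Z' := expansion _ _.
have shiftK : decays (m.+2%:R * l) (fun t => `|Z' t - Z t -
    \sum_i expR (- lam i * t) *: (modes (fun i => a i + b i) i - modes a i)|).
  rewrite Kl addrC; apply: expansion_shift => // i /b0 bi0.
  by rewrite /modes bi0 addr0.
apply: (eq_decays_norm (p := fun t => (x t - Z t -
    \sum_i (b i * expR (- lam i * t)) *: dual_basis V i) - (Z' t - Z t -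
    \sum_i expR (- lam i * t) *: (modes (fun i => a i + b i) i - modes a i)))).
  move=> t; have -> : \sum_i expR (- lam i * t) *:
      (modes (fun i => a i + b i) i - modes a i) =
      \sum_i (b i * expR (- lam i * t)) *: dual_basis V i.
    apply: eq_bigr => i _.
    by rewrite /modes -scalerBl addrAC subrr add0r scalerA mulrC.
  by rewrite opprB addrA subrK opprB addrA subrK.
exact: decays_normD bK (decays_normN shiftK).
Unshelve. all: by end_near. Qed.

(** Each step of the bootstrap only modifies the [a i] with [m.+1%:R * l <= lam i];
    from [m0] on there is none, and the same [a] fits all orders. *)
Lemma solution_expansion (x : R -> 'rV[R]_n) :
  solves L (fun t => N (x t)) x -> x t @[t --> +oo] --> (0 : 'rV[R]_n) ->
  exists a m0, forall m, (m0 <= m)%N ->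
    decays (m.+1%:R * l) (fun t => `|x t - expansion (modes a) m t|).
Proof.
move=> xN x0; have [C C0 NC] := quadratic_lipschitz N_smooth JN0.
have xl : decays l (fun t => `|x t|).
  apply: (apriori_decay V_unit VL (N := N) l_lam C0) => // v v1.
  have := NC v 0 v1; rewrite normr0 N0 !subr0 addr0 => /(_ ler01).
  by rewrite -mulrA -expr2.
have next a m : decays (m.+1%:R * l) (fun t => `|x t - expansion (modes a) m t|) ->
    decays (m.+1%:R * l) (fun t => `|x t - expansion (modes a) m.+1 t|).
  move=> xK; have := decays_normD xK (decays_normN (@expansion_step (modes a) m)).
  by apply: eq_decays_norm => t; rewrite opprB addrA subrK.
have exist_a m : exists a,
    decays (m.+1%:R * l) (fun t => `|x t - expansion (modes a) m t|).
  elim: m => [|m [a /next xK]]; last first.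
    have [b [_ bK]] := expansion_improve xN xl xK.
    by exists (fun i => a i + b i).
  exists (fun=> 0); rewrite mul1r; have := xl; apply: eq_decays_norm => t.
  rewrite /expansion big_seq big1 ?subr0 // => chi.
  by rewrite mem_indices leqn0 => /eqP/degree_eq0 ->; rewrite c0 scaler0.
(* beyond this degree no [lam i] reaches the rate [m.+1%:R * l] *)
pose m0 := \max_i Num.truncn (lam i / l).
have lam_m0 i m : (m0 <= m)%N -> lam i < m.+1%:R * l.
  move=> m0m; rewrite -ltr_pdivrMr //.
  apply: lt_le_trans (truncnS_gt _) _; rewrite ler_nat ltnS.
  exact: leq_trans (leq_bigmax i) m0m.
have [a am0] := exist_a m0.
have {}am0 m : m = m0 ->
    decays (m.+1%:R * l) (fun t => `|x t - expansion (modes a) m t|) by move=> ->.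
exists a, m0; elim=> [|m IHm].
  by rewrite leqn0 => /eqP /esym; exact: am0.
rewrite leq_eqVlt ltnS => /predU1P[/esym|m0m]; first exact: am0.
have [b [b0 bK]] := expansion_improve xN xl (next a m (IHm m0m)).
by have -> : a = (fun i => a i + b i)
  by apply/funext => i; rewrite b0 ?addr0 // lam_m0.
Qed.
End FormalExpansion.

(** * Uniqueness for the initial value problem *)

Section Uniqueness.
Context {R : realType} {n : nat}.
Variables (L : 'M[R]_n) (N : 'rV[R]_n -> 'rV[R]_n).
Hypothesis N_smooth : smooth N.

Lemma is_solution_solves x : is_solution L N x -> solves L (fun t => N (x t)) x.
Proof. by move=> [_ xE] t /xE xt j; exact: is_derive_row. Qed.

Lemma is_solution_bounded x T : is_solution L N x ->
  exists2 C, 0 <= C & forall t, 0 <= t <= T -> `|x t| <= C.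
Proof.
move=> [xc _].
have /compact_bounded[M [Mreal Mle]] : compact (x @` `[0, T]).
  apply: continuous_compact; last exact: segment_compact.
  apply: continuous_subspaceW xc => t /=.
  by rewrite !in_itv /= andbT => /andP[].
exists (`|M| + 1) => [|t tT]; first by rewrite addr_ge0.
apply: (Mle (`|M| + 1)) => /=; first by rewrite ltr_pwDr ?ler_norm.
by exists t => //=; rewrite in_itv.
Qed.

Lemma lipschitz_on_ball r : exists2 C, 0 <= C & forall x y : 'rV[R]_n,
  `|x| <= r -> `|y| <= r -> `|N x - N y| <= C * `|x - y|.
Proof.
have /(_ _)/cid2-/all_sig2[B B0 dB] := fun i =>
  bounded_on_ball (3 * r) (smooth_continuous (smooth_derive i N_smooth)).
exists (n%:R * \sum_i B i) => [|x y xr yr]; first by rewrite mulr_ge0 // sumr_ge0.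
apply: (@lipschitz_bound _ _ _ (3 * r)) => //.
- exact: sumr_ge0.
- move=> i p pr; apply: le_trans (dB i p pr) _.
  by rewrite (bigD1 i) //= lerDl sumr_ge0.
by have := ler_normB x y; lra.
Qed.

(** Gronwall: on [0, T] both solutions stay in a ball, where [N] is Lipschitz, and
    the sum of the squares of the coordinates of the difference, multiplied by
    a decreasing exponential, is nonincreasing. *)
Lemma solution_unique x y : is_solution L N x -> is_solution L N y -> x 0 = y 0 ->
  forall t, 0 <= t -> x t = y t.
Proof.
move=> xs ys xy0 T T0.
have [xc _] := xs; have [yc _] := ys.
have [rx rx0 xr] := is_solution_bounded T xs.
have [ry ry0 yr] := is_solution_bounded T ys.
have [C C0 NC] := lipschitz_on_ball (rx + ry).
have [CL CL0 LC] := mulmx_bound L^T.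
pose w t := x t - y t.
pose dw t := w t *m L^T + (N (x t) - N (y t)).
have wE (t : R) : 0 < t -> forall j, is_derive t 1 (fun t => w t 0 j) (dw t 0 j).
  move=> t0 j; have -> : (fun t => w t 0 j) = (fun t => x t 0 j) - (fun t => y t 0 j).
    by apply/funext => s; rewrite !mxE.
  have xE := is_solution_solves xs t0 j; have yE := is_solution_solves ys t0 j.
  apply: is_derive_eq (is_deriveB xE yE) _.
  by rewrite /dw /w mulmxBl !mxE; ring.
pose sq (v : 'rV[R]_n) := \sum_i v 0 i ^+ 2.
pose k := 2 * (n%:R * (CL + C)).
pose g t := expR (- k * t) * sq (w t).
have gE (t : R) : 0 < t -> is_derive t 1 g
    (expR (- k * t) * (2 * \sum_i w t 0 i * dw t 0 i) + - k * expR (- k * t) * sq (w t)).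
  by move=> t0; exact: is_derive_mul (is_derive_expM _ _) (is_derive_sqr_sum (wE t t0)).
have dg_le0 t : 0 < t < T -> expR (- k * t) * (2 * \sum_i w t 0 i * dw t 0 i) +
    - k * expR (- k * t) * sq (w t) <= 0.
  move=> /andP[t0 tT].
  have h : \sum_i w t 0 i * dw t 0 i <= n%:R * (CL + C) * sq (w t).
    apply: sum_mul_le; first exact: addr_ge0.
    rewrite mulrDl; apply: le_trans (ler_normD _ _) _; apply: lerD; first exact: LC.
    have t0T : 0 <= t <= T by rewrite !ltW.
    by apply: NC; [have := xr t t0T | have := yr t t0T]; lra.
  have := ler_wpM2l (expR_ge0 (- k * t)) h; rewrite /k; lra.
have sqc : continuous sq.
  rewrite (_ : sq = \sum_i ((fun v : 'rV[R]_n => v 0 i) ^+ 2)); last first.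
    by apply/funext => v; rewrite fct_sumE.
  move=> v; apply: differentiable_continuous; apply: differentiable_sum => i.
  exact/differentiableX/differentiable_coord.
have gc : {within `[0, T], continuous g}.
  have wc : {within `[0, T], continuous w}.
    have sub : (`[0, T] : set R) `<=` `[0, +oo[.
      by move=> t /=; rewrite !in_itv /= andbT => /andP[].
    move=> t; apply: continuousB.
      exact: (continuous_subspaceW sub xc).
    exact: (continuous_subspaceW sub yc).
  have ec : continuous (fun t : R => expR (- k * t)).
    move=> t; apply: differentiable_continuous; apply/derivable1_diffP.
    by have [] := is_derive_expM (- k) t.
  have {}ec := @continuous_subspaceT _ _ `[0, T] _ ec.
  have sw : {within `[0, T], continuous (sq \o w)}.
    move=> t.
    exact: (@continuous_comp (subspace (`[0, T] : set R)) 'rV[R]_n R w sq t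
      (wc t) (sqc (w t))).
  by move=> t; have := continuousM (ec t) (sw t).
have gT : g T <= g 0.
  have dg1 t : t \in `]0, T[%R -> derivable g t 1.
    by rewrite in_itv /= => /andP[t0 _]; have [] := gE t t0.
  have dg2 t : t \in `]0, T[%R -> derive1 g t <= 0.
    rewrite in_itv /= => tT; have /andP[t0 _] := tT.
    by have [_ dE] := gE t t0; rewrite derive1E dE dg_le0.
  have := @ler0_derive1_le_cc R g 0 T dg1 dg2 gc T 0.
  by rewrite !in_itv /= !lexx T0 => /(_ isT isT isT).
have sq0 : sq (w T) <= 0.
  move: gT; rewrite /g [sq (w 0)](_ : _ = 0); last first.
    by rewrite /sq big1 // => i _; rewrite /w xy0 subrr mxE expr0n.
  by rewrite mulr0 pmulr_rle0 ?expR_gt0.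
apply/eqP; rewrite -subr_eq0 -normr_eq0 -sqrf_eq0 eq_le sqr_ge0 andbT.
exact: le_trans (sqr_norm_le _) sq0.
Qed.
End Uniqueness.

(** * From decay rates to the asymptotic expansion *)

(** Among finitely many multi-indices, those of weight larger than [Theta] leave a
    gap above [Theta]: this provides the [eps0] of the theorem. *)
Lemma weight_gap (R : realType) (n : nat) (lam : 'I_n -> R) (Theta : R)
    (r : seq (multi_index n)) :
  exists eps0, [/\ 0 < eps0, eps0 <= 1 & forall chi, chi \in r ->
    Theta < weight lam chi -> Theta + eps0 <= weight lam chi].
Proof.
elim: r => [|chi r [e [e0 e1 er]]]; first by exists 1; split.
have [wchi|wchi] := leP (weight lam chi) Theta.
  exists e; split=> // chi'; rewrite inE => /predU1P[->|]; last exact: er.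
  by rewrite ltNge wchi.
exists (Num.min e (weight lam chi - Theta)); split.
- by rewrite lt_min e0 subr_gt0.
- by rewrite ge_min e1.
move=> chi'; rewrite inE => /predU1P[-> _|chir' wchi'].
  by rewrite -lerBrDl ge_min lexx orbT.
by apply: le_trans (er _ chir' wchi'); rewrite lerD2l ge_min lexx.
Qed.

Lemma index_set_sum (R : realType) (n : nat) (lam : 'I_n -> R) (l Theta : R) m
    (f : multi_index n -> R) : 0 < l -> (forall i, l <= lam i) -> Theta < m.+1%:R * l ->
  \sum_(chi \in index_set lam Theta) f chi =
  \sum_(chi <- indices n m | weight lam chi <= Theta) f chi.
Proof.
move=> l0 llam Thm; rewrite -[RHS]big_filter [RHS]fsbig_seq ?filter_uniq ?indices_uniq //.
suff -> : index_set lam Theta =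
  [set` [seq chi <- indices n m | weight lam chi <= Theta]] by [].
apply/seteqP; split=> chi /=.
  rewrite mem_filter mem_indices /index_set /= => wT; rewrite wT /= -ltnS.
  have := le_lt_trans (le_trans (degree_weight llam chi) wT) Thm.
  by rewrite ltr_pM2r // ltr_nat.
by rewrite mem_filter => /andP[].
Qed.

(** Truncate at a degree [m] so large that the error has a rate above [Theta + 1]; the
    terms of the truncation that are not in the sum have a weight at least
    [Theta + eps0]. *)
Lemma expansion_littleo (R : realType) (n : nat) (lam : 'I_n -> R) (l : R)
    (c : multi_index n -> ('I_n -> 'rV[R]_n) -> 'rV[R]_n) D (x : R -> 'rV[R]_n) m0 :
  0 < l -> (forall i, l <= lam i) ->
  (forall m, (m0 <= m)%N ->
    decays (m.+1%:R * l) (fun t => `|x t - expansion lam c D m t|)) ->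
  forall Theta : R, exists2 eps0 : R, 0 < eps0 &
    forall eps : R, 0 < eps -> eps < eps0 -> forall s : 'I_n,
      littleo_exp (Theta + eps) (fun t => x t 0 s -
        \sum_(chi \in index_set lam Theta)
          c chi D 0 s * expR (- weight lam chi * t)).
Proof.
move=> l0 llam xm Theta.
pose m := maxn m0 (Num.truncn ((Theta + 1) / l)).
have Thm : Theta + 1 < m.+1%:R * l.
  rewrite -ltr_pdivrMr //; apply: lt_le_trans (truncnS_gt _) _.
  by rewrite ler_nat ltnS leq_maxr.
have Thm' : Theta < m.+1%:R * l by apply: lt_trans Thm; rewrite ltrDl.
have [e [e0 e1 eP]] := weight_gap lam Theta (indices n m).
exists e => // eps eps0 epse s.
apply: (@decays_littleo _ (Theta + e)); last by rewrite ltrD2l.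
(* the test drops nothing: no index of [indices n m] has a weight strictly
   between [Theta] and [Theta + e] *)
pose tail t := \sum_(chi <- [seq chi <- indices n m | ~~ (weight lam chi <= Theta)])
  expR (- weight lam chi * t) *:
    (if Theta + e <= weight lam chi then c chi D else 0).
apply: (@eq_decays _ _ _ (fun t => (x t - expansion lam c D m t) 0 s + tail t 0 s)).
  apply: nearW => t; rewrite (index_set_sum _ l0 llam Thm') [in RHS]mxE.
  rewrite -[RHS]addrA; congr (_ + _).
  have -> : tail t = \sum_(chi <- indices n m | ~~ (weight lam chi <= Theta))
      expR (- weight lam chi * t) *: c chi D.
    rewrite /tail -[RHS]big_filter; apply: eq_big_seq => chi.
    by rewrite mem_filter -ltNge => /andP[wchi chi_m]; rewrite eP.
  rewrite /expansion [in RHS]mxE !summxE.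
  rewrite [in RHS](bigID (fun chi => weight lam chi <= Theta)) /= opprD subrK.
  by congr (- _); apply: eq_bigr => chi _; rewrite mxE mulrC.
apply: decaysD; apply: decays_coord.
  apply: decays_le (xm m (leq_maxl _ _)); apply: ltW; apply: le_lt_trans Thm.
  by rewrite lerD2l.
apply: decays_norm_sum => chi _; apply: decays_term.
by case: ifP => [echi|_]; [left | right].
Qed.

(* lam i is the paper's wedge_(i+1).  The n distinct real numbers - lam i are
   all the (complex) eigenvalues of the n x n matrix L.
   d (x 0) i is the vector d_i of the solution x, and c chi D is the vector
   c^chi as a function of the tuple D = (d_1, ..., d_n). *)
Theorem propositionA11 (R : realType) (n : nat) (L : 'M[R]_n)
  (N : 'rV[R]_n -> 'rV[R]_n) (lam : 'I_n -> R)
  (N_smooth : smooth N) (N0 : N 0 = 0) (JN0 : 'J N 0 = 0)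
  (eigenL : forall a : R, eigenvalue L a <-> exists i, a = - lam i)
  (lam_gt0 : forall i, 0 < lam i)
  (lam_incr : forall i j : 'I_n, (i < j)%N -> - lam j < - lam i)
  (nonresonant : forall (i : 'I_n) (chi : multi_index n),
     lam i <> \sum_(j < n | (j < i)%N) (chi j)%:R * lam j) :
  exists (d : 'rV[R]_n -> 'I_n -> 'rV[R]_n)
         (c : multi_index n -> ('I_n -> 'rV[R]_n) -> 'rV[R]_n),
  [/\ forall (i : 'I_n) (D : 'I_n -> 'rV[R]_n), c (unit_index i) D = D i,
      forall (i : 'I_n) (chi : multi_index n),
        (forall j : 'I_n, (i < j)%N -> chi j = 0%N) ->
        forall D D' : 'I_n -> 'rV[R]_n,
          (forall j : 'I_n, (j <= i)%N -> D j = D' j) -> c chi D = c chi D'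
    & forall x : R -> 'rV[R]_n,
        is_solution L N x -> x t @[t --> +oo] --> (0 : 'rV[R]_n) ->
        forall Theta : R, 0 < Theta ->
        exists2 eps0 : R, 0 < eps0 &
        forall eps : R, 0 < eps -> eps < eps0 ->
        forall s : 'I_n,
          littleo_exp (Theta + eps)
            (fun t => x t 0 s -
               \sum_(chi \in index_set lam Theta)
                 c chi (d (x 0)) 0 s * expR (- weight lam chi * t))].
Proof.
have [n0|n_gt0] := posnP n.
  have noI (i : 'I_n) : False by case: i => i; rewrite n0.
  exists (fun _ _ => 0), (fun _ _ => 0); split=> [i|i|x _ _ Theta _].
  - by case: (noI i).
  - by case: (noI i).
  - by exists 1 => // eps _ _ s; case: (noI s).
pose l := lam (Ordinal n_gt0); have l0 : 0 < l := lam_gt0 _.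
have llam i : l <= lam i.
  have [i0|i_gt0] := posnP i.
    by rewrite (_ : i = Ordinal n_gt0) //; exact/val_inj.
  by have := lam_incr (Ordinal n_gt0) i i_gt0; rewrite ltrN2 => /ltW.
have lam_inj : injective (fun i => - lam i).
  move=> i j /eqP; apply: contraTeq => /negPf ij; case: (ltngtP i j) => [h|h|/val_inj h].
  - by rewrite gt_eqF // lam_incr.
  - by rewrite lt_eqF // lam_incr.
  - by rewrite h eqxx in ij.
have [V V_unit VL] : exists2 V : 'M[R]_n, V \in unitmx &
    forall i, row i V *m L = - lam i *: row i V.
  by apply: (distinct_eigenbasis lam_inj) => i; apply/eigenL; exists i.
have [c [c0 cU c_tri c_formal]] :=
  formal_solution (taylor_coef N) (resolvent L lam).
pose expands x D := exists m0, forall m, (m0 <= m)%N ->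
  decays (m.+1%:R * l) (fun t => `|x t - expansion lam c D m t|).
have expandsP x : is_solution L N x -> x t @[t --> +oo] --> (0 : 'rV[R]_n) ->
    exists D, expands x D.
  move=> /is_solution_solves xN x0.
  have [a [m0 am0]] := solution_expansion N_smooth N0 JN0 eigenL l0 llam lam_incr
    nonresonant c0 cU c_tri c_formal V_unit VL xN x0.
  by exists (modes V a), m0.
have [d dP] : exists d : 'rV[R]_n -> 'I_n -> 'rV[R]_n, forall x,
    is_solution L N x -> x t @[t --> +oo] --> (0 : 'rV[R]_n) -> expands x (d (x 0)).
  suff /choice[d dP] : forall v : 'rV[R]_n, exists D, forall x,
      is_solution L N x -> x t @[t --> +oo] --> (0 : 'rV[R]_n) -> x 0 = v ->
      expands x D.
    by exists d => x xN x0; exact: dP.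
  (* any solution from [v] serves, as they all agree for [t >= 0] *)
  move=> v; have [[x [xN x0 xv]]|nox] := pselect (exists x, [/\ is_solution L N x,
      x t @[t --> +oo] --> (0 : 'rV[R]_n) & x 0 = v]); last first.
    by exists (fun=> 0) => x xN x0 xv; case: nox; exists x.
  have [D [m0 Dm0]] := expandsP x xN x0; exists D => y yN y0 yv.
  exists m0 => m /Dm0; apply: eq_decays.
  apply: filterS (nbhs_pinfty_ge (num_real 0)) => t t0.
  by rewrite (solution_unique N_smooth xN yN) // xv.
exists d, c; split=> // x xN x0 Theta _.
have [m0 xm0] := dP x xN x0.
exact: expansion_littleo l0 llam xm0 Theta.
Qed.
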